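(* The set $$\mathcal R:=\{A\in C^\alpha(\Sigma,\mathbb R):\ \mathcal M(A)=\{\mu\}\text{ for some }\mu,\ \mathcal A(A)=\operatorname{supp}(\mu)\}$$ contains a residual subset of $C^\alpha(\Sigma,\mathbb R)$.
   Context: $\Sigma=\{1,\dots,d\}^{\mathbb N}$, $T$ the left shift, metric $d(\omega,\nu)=\lambda^N$, $N=\min\{k:\omega_k\ne\nu_k\}$, $0<\lambda<1$; $C^\alpha(\Sigma,\mathbb R)$ carries the norm $\|F\|_\alpha=\sup|F|+\sup_{x\ne y}|F(x)-F(y)|/d(x,y)^\alpha$. $m_A=\max\{\int A\,d\mu:\mu\ T\text{-invariant}\}$ and $\mathcal M(A)$ is the set of $T$-invariant probabilities with $\int A\,d\mu=m_A$. Mañé potential $S_A(x,y)=\lim_{\epsilon\to0}\sup\{\sum_{i=0}^{n-1}[A(T^iz)-m_A]:n\in\mathbb N,\ T^nz=y,\ d(z,x)<\epsilon\}$; Aubry set $\mathcal A(A)=\{x:S_A(x,x)=0\}$. *)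

(* Defs.v *)
From Stdlib Require Import Reals Lra ClassicalEpsilon.
Open Scope R_scope.

(** Alphabet {0,...,d-1} (the paper's {1,...,d}) and Sigma = alphabet^N. *)
Definition sym (d : nat) := {k : nat | (k < d)%nat}.
Definition Sigma (d : nat) := nat -> sym d.

Definition shift {d} (x : Sigma d) : Sigma d := fun n => x (S n).

Definition same {d} (x y : Sigma d) : Prop := forall n, x n = y n.

(** N = min {k : x_k <> y_k}  (only meaningful when x, y differ) *)
Definition first_diff {d} (x y : Sigma d) : nat :=
  epsilon (inhabits 0%nat)
    (fun N => x N <> y N /\ forall k, (k < N)%nat -> x k = y k).

Definition dist {d} (lam : R) (x y : Sigma d) : R :=
  if excluded_middle_informative (same x y) then 0 else lam ^ first_diff x y.

Definition is_open {d} (lam : R) (V : Sigma d -> Prop) : Prop :=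
  forall x, V x -> exists eps, 0 < eps /\ forall y, dist lam x y < eps -> V y.

Inductive borel {d} (lam : R) : (Sigma d -> Prop) -> Prop :=
| borel_open V : is_open lam V -> borel lam V
| borel_compl B : borel lam B -> borel lam (fun x => ~ B x)
| borel_union (B : nat -> Sigma d -> Prop) :
    (forall n, borel lam (B n)) -> borel lam (fun x => exists n, B n x)
| borel_ext B B' : borel lam B -> (forall x, B x <-> B' x) -> borel lam B'.

(** Borel probability measures (values on non-Borel sets are irrelevant) *)
Definition prob_measure {d} (lam : R) (mu : (Sigma d -> Prop) -> R) : Prop :=
  (forall B B', (forall x, B x <-> B' x) -> mu B = mu B') /\
  (forall B, borel lam B -> 0 <= mu B) /\
  mu (fun _ => True) = 1 /\
  (forall B : nat -> Sigma d -> Prop,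
     (forall n, borel lam (B n)) ->
     (forall n m x, n <> m -> B n x -> B m x -> False) ->
     infinite_sum (fun n => mu (B n)) (mu (fun x => exists n, B n x))).

Definition invariant {d} (lam : R) (mu : (Sigma d -> Prop) -> R) : Prop :=
  prob_measure lam mu /\
  forall B, borel lam B -> mu (fun x => B (shift x)) = mu B.

(** Lebesgue integral of a bounded measurable F: limit of the integrals of the
    dyadic lower simple approximations (truncated to [-n, n+2^-n)). *)
Definition integral_approx {d} (mu : (Sigma d -> Prop) -> R) (F : Sigma d -> R)
  (n : nat) : R :=
  sum_f_R0
    (fun j => let t := (INR j - INR n * 2 ^ n) / 2 ^ n in
              t * mu (fun x => t <= F x < t + / 2 ^ n))
    (2 * n * 2 ^ n)%nat.

Definition is_integral {d} (mu : (Sigma d -> Prop) -> R) (F : Sigma d -> R)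
  (I : R) : Prop := Un_cv (integral_approx mu F) I.

(** m_A = max { int A dmu : mu T-invariant } (taken as the supremum) *)
Definition mA {d} (lam : R) (A : Sigma d -> R) : R :=
  epsilon (inhabits 0)
    (fun m => is_lub (fun r => exists mu, invariant lam mu /\ is_integral mu A r) m).

Definition maximizing {d} (lam : R) (A : Sigma d -> R)
  (mu : (Sigma d -> Prop) -> R) : Prop :=
  invariant lam mu /\ is_integral mu A (mA lam A).

(** The set whose sup defines S_A(x,y) at scale eps (n >= 1) *)
Definition mane_set {d} (lam : R) (A : Sigma d -> R) (x y : Sigma d) (eps : R)
  (s : R) : Prop :=
  exists (n : nat) (z : Sigma d),
    (1 <= n)%nat /\ same (Nat.iter n shift z) y /\ dist lam z x < eps /\
    s = sum_f_R0 (fun i => A (Nat.iter i shift z) - mA lam A) (n - 1).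

(** x in Aubry set: S_A(x,x) = lim_{eps->0} sup mane_set = 0 *)
Definition aubry {d} (lam : R) (A : Sigma d -> R) (x : Sigma d) : Prop :=
  forall eta, 0 < eta -> exists delta, 0 < delta /\
    forall eps, 0 < eps < delta ->
      exists s, is_lub (mane_set lam A x x eps) s /\ Rabs s < eta.

Definition support {d} (lam : R) (mu : (Sigma d -> Prop) -> R) (x : Sigma d) : Prop :=
  forall V, is_open lam V -> V x -> 0 < mu V.

Definition is_holder {d} (lam alpha : R) (F : Sigma d -> R) : Prop :=
  (exists M, forall x, Rabs (F x) <= M) /\
  (exists C, forall x y, ~ same x y ->
      Rabs (F x - F y) <= C * Rpower (dist lam x y) alpha).

Definition norm_lt {d} (lam alpha : R) (H : Sigma d -> R) (eps : R) : Prop :=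
  exists r1 r2, 0 <= r2 /\ r1 + r2 < eps /\
    (forall z, Rabs (H z) <= r1) /\
    (forall x y, ~ same x y ->
       Rabs (H x - H y) / Rpower (dist lam x y) alpha <= r2).

Definition holder_open {d} (lam alpha : R) (U : (Sigma d -> R) -> Prop) : Prop :=
  forall F, is_holder lam alpha F -> U F ->
    exists eps, 0 < eps /\ forall G, is_holder lam alpha G ->
      norm_lt lam alpha (fun x => G x - F x) eps -> U G.

Definition holder_dense {d} (lam alpha : R) (U : (Sigma d -> R) -> Prop) : Prop :=
  forall F, is_holder lam alpha F -> forall eps, 0 < eps ->
    exists G, is_holder lam alpha G /\ U G /\
      norm_lt lam alpha (fun x => G x - F x) eps.

Definition contains_residual {d} (lam alpha : R) (P : (Sigma d -> R) -> Prop) : Prop :=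
  exists U : nat -> (Sigma d -> R) -> Prop,
    (forall n, holder_open lam alpha (U n) /\ holder_dense lam alpha (U n)) /\
    forall F, is_holder lam alpha F -> (forall n, U n F) -> P F.

Definition setR {d} (lam : R) (A : Sigma d -> R) : Prop :=
  exists mu, maximizing lam A mu /\
    (forall nu, maximizing lam A nu -> forall B, borel lam B -> nu B = mu B) /\
    (forall x, aubry lam A x <-> support lam mu x).

(* Main.v *)
From Stdlib Require Import Reals Lra Lia Classical ClassicalEpsilon FunctionalExtensionality Wf_nat.
From mathcomp Require ssreflect ssrfun ssrbool eqtype ssrnat seq choice fintype finfun finset.
From mathcomp Require bigop binomial path div prime zify.
Require Import Defs.
Open Scope R_scope.

(** The set contains even an open dense one, on which the maximizing measure is
    carried by a periodic orbit that is also the Aubry set.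

    Put [th = lam ^ alpha], so that Hölder means [|F x - F y| <= C th^n] when [x]
    and [y] agree on [n] symbols. A sub-action turns [F] into a cohomologous
    [A <= m]; normalize [m = 0]. Arbitrarily long orbit pieces nearly realize
    [A = 0], and their words form a factorial language. By the counting argument
    of Bressaud and Quas there are periodic orbits whose [N]-windows all lie in
    that language and whose period is at most [e^(delta N)] for any prescribed
    [delta > 0]; their Birkhoff sum beats every negative power of the period.
    Cutting such an orbit at close returns yields a periodic orbit [O] whose
    total defect [- sum_O A] is tiny compared with [th^g], where points of [O]
    that agree on [g + 1] symbols coincide. Subtracting a small multiple of
    [dist(., O)^alpha] then makes [O] strictly optimal, and this survives all
    small Hölder perturbations: an orbit near [O] gains at most the defect before
    it has to pay for moving away to the scale of the gap. The resulting strict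
    cohomological inequality is integrated with finite sums over cylinders. *)

(** * Short periodic orbits in a factorial language *)

(** The obstacle is that a cheap periodic orbit may come much closer to itself than its cost allows.
    A cut at a close return multiplies the bound on the cost by the constant [1 + C / (1 - th) * Pc]
    and at least halves the period. An orbit of period at most [2 ^ k] is cut at most [k] times, so
    the total loss is exponential in [k], that is, a power of the period bound. Hence the need for a
    cost below every negative power of the period. Windows of length [a * k] with period at most
    [4 ^ k] meet it: each point costs about [th ^ (a * k)], and [a] is chosen after all the
    constants of the loss. The order of choice is [eps], then the number [s] of symbols beyond the
    gap scale, then [Pc], then [a]. The multiple of the distance that is subtracted is [2 * eps].
    One half is spent on locking. The other half survives as strictness in the cohomological
    inequality, and this gives uniqueness of the measure and keeps the Aubry set inside the
    orbit. *)

Definition agree {d} (n : nat) (x y : Sigma d) : Prop :=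
  forall k, (k < n)%nat -> x k = y k.

Definition shift_by {d} (i : nat) (x : Sigma d) : Sigma d := fun n => x (i + n)%nat.

Module Combinatorics.
Import ssreflect ssrfun ssrbool eqtype ssrnat seq choice fintype finfun finset.
Import bigop binomial path div prime zify.
Set Implicit Arguments.
Unset Strict Implicit.
Unset Printing Implicit Defensive.
Local Open Scope nat_scope.

Definition asb (Q : Prop) : bool := if excluded_middle_informative Q then true else false.

Lemma asbP (Q : Prop) : reflect Q (asb Q).
Proof. by rewrite /asb; case: excluded_middle_informative => ?; constructor. Qed.

Definition sh (S : Type) (i : nat) (x : nat -> S) : nat -> S := fun j => x (i + j).

Definition extend (S : Type) (s0 : S) n (w : {ffun 'I_n -> S}) : nat -> S :=
  fun i => if insub i is Some j then w j else s0.

Definition block (S : Type) n (x : nat -> S) i : {ffun 'I_n -> S} :=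
  [ffun j : 'I_n => x (i * n + j)].

Definition join (S : Type) (s0 : S) n (b b' : {ffun 'I_n -> S}) : nat -> S :=
  fun i => if i < n then extend s0 b i else extend s0 b' (i - n).

(** A factorial language, encoded on infinite sequences to avoid words of varying length: [P n x]
    depends on the first [n] letters of [x] and passes to factors. *)
Definition prefix_pred (S : Type) (P : nat -> (nat -> S) -> Prop) : Prop :=
  (forall n x y, (forall i, i < n -> x i = y i) -> P n x -> P n y) /\
  (forall i n j x, P (i + n + j) x -> P n (sh i x)).

Definition words (S : finType) (s0 : S) (P : nat -> (nat -> S) -> Prop) n :
  {set {ffun 'I_n -> S}} := [set w | asb (P n (extend s0 w))].

(** The whole concatenation has to be allowed, so that every window of length [n] along a walk,
    straddling at most two blocks, is allowed too. *)
Definition edge (S : finType) (s0 : S) (P : nat -> (nat -> S) -> Prop) n :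
  rel {ffun 'I_n -> S} := fun b b' => asb (P (n + n) (join s0 b b')).

Lemma extendE (S : Type) (s0 : S) n (w : {ffun 'I_n -> S}) i (lt_i : i < n) :
  extend s0 w i = w (Ordinal lt_i).
Proof. by rewrite /extend insubT. Qed.

Lemma join_block (S : finType) (s0 : S) n (x : nat -> S) i j : j < n + n ->
  join s0 (block n x i) (block n x i.+1) j = sh (i * n) x j.
Proof.
move=> ltj; rewrite /join /sh; case: ltnP => ltjn.
  by rewrite (extendE _ _ ltjn) ffunE.
have lt' : j - n < n by rewrite ltn_subLR.
by rewrite (extendE _ _ lt') ffunE /= mulSn addnAC subnKC // addnC.
Qed.

(** Repeat the blocks of the cycle forever: the window at [i] starts in block [i %/ n] and ends no
    later than the next block. *)
Lemma cycle_point (S : finType) (s0 : S) P n c :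
  prefix_pred P -> 0 < n -> 0 < size c -> cycle (edge s0 P (n := n)) c ->
  exists x : nat -> S, (forall i, x (i + size c * n) = x i) /\
    forall i, P n (sh i x).
Proof.
move=> [Pext Psub] n0 m0 cc.
case: c m0 cc => // b0 s _ cc; set c := b0 :: s; set m := size c.
have m0 : 0 < m by [].
pose f q := nth b0 c (q %% m).
pose x i := extend s0 (f (i %/ n)) (i %% n).
have ed q : edge s0 P (f q) (f q.+1).
  have lt : q %% m < m by rewrite ltn_mod.
  have := cc; rewrite /= => /(pathP b0)/(_ (q %% m)).
  rewrite size_rcons => /(_ lt); rewrite -rcons_cons nth_rcons -/c -/m lt -/(f q).
  suff -> : nth b0 (rcons s b0) (q %% m) = f q.+1 by [].
  have -> : f q.+1 = nth b0 c ((q %% m).+1 %% m) by rewrite /f -(addn1 q) -modnDml addn1.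
  rewrite nth_rcons.
  have : q %% m <= size s by rewrite -ltnS; exact: lt.
  rewrite leq_eqVlt => /orP[/eqP e|lt'].
    by rewrite e ltnn eqxx modnn.
  rewrite lt' [_.+1 %% m]modn_small; [by []|exact: lt'].
exists x; split=> i.
  by rewrite /x divnDMl // (addnC i) modnMDl /f modnDr.
have bl q j : j < n + n -> join s0 (f q) (f q.+1) j = sh (q * n) x j.
  move=> lj; rewrite /join /sh /x; case: ltnP => lt.
    by rewrite divnMDl // modnMDl divn_small // modn_small // addn0.
  have lt' : j - n < n by rewrite ltn_subLR.
  rewrite -{2 3}(subnK lt) (addnC _ n) addnA -mulSnr divnMDl // modnMDl.
  by rewrite divn_small // modn_small // addn0.
have Pq : P (n + n) (sh (i %/ n * n) x).
  by apply: Pext (bl (i %/ n)) _; apply/asbP; apply: ed.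
have := Psub (i %% n) n (n - i %% n) (sh (i %/ n * n) x).
rewrite addnAC subnKC; last by rewrite ltnW // ltn_mod.
move=> /(_ Pq); apply: Pext => j _.
by rewrite /sh addnA -divn_eq.
Qed.

(* If no closed walk of blocks is short, the order of the blocks of a word is
   determined by their set, so long words are at most as many as sets of blocks. *)
Lemma card_words_acyclic (S : finType) (s0 : S) P n t :
  prefix_pred P -> 0 < n ->
  (forall c, 0 < size c <= t + t -> ~~ cycle (edge s0 P (n := n)) c) ->
  #|words s0 P (t * n)| * t`! <= #|words s0 P n| ^ t.
Proof.
move=> [Pext Psub] n0 acyc.
pose bls (w : {ffun 'I_(t * n) -> S}) := [seq block n (extend s0 w) i | i <- iota 0 t].
(* Reachability in at most [t] steps. Two such walks in opposite directions close up to at most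
   [t + t] blocks, which explains the bound in the hypothesis. *)
pose r (b b' : {ffun 'I_n -> S}) :=
  asb (exists s, size s < t /\ path (edge s0 P (n := n)) b (rcons s b')).
have r_irr : irreflexive r.
  move=> b; apply/asbP => -[s [ls ps]].
  have : ~~ cycle (edge s0 P (n := n)) (b :: s) by apply: acyc; rewrite /= ltn_addl.
  by rewrite /= ps.
have r_asym : antisymmetric r.
  move=> b b' /andP[/asbP[s [ls ps]] /asbP[s' [ls' ps']]].
  have : ~~ cycle (edge s0 P (n := n)) (b :: s ++ b' :: s').
    by apply: acyc; rewrite /= size_cat /= -addSn; exact: leq_add.
  by rewrite /= rcons_cat /= -cat_rcons cat_path ps last_rcons ps'.
have bls_pw w : w \in words s0 P (t * n) -> pairwise r (bls w).
  rewrite inE => /asbP Pw.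
  have ed i : i.+1 < t -> edge s0 P (block n (extend s0 w) i) (block n (extend s0 w) i.+1).
    move=> lit; apply/asbP.
    apply: Pext (fun j lj => esym (join_block s0 (extend s0 w) i lj)) _.
    apply: (Psub _ _ (t * n - (i * n + (n + n)))).
    by rewrite subnKC // addnA -!mulSnr leq_mul2r lit orbT.
  apply/(pairwiseP (block n (extend s0 w) 0)) => i j; rewrite !inE !size_map !size_iota.
  move=> li lj lij; rewrite !(nth_map 0) ?size_iota // !nth_iota // !add0n.
  apply/asbP; exists [seq block n (extend s0 w) k | k <- iota i.+1 (j - i).-1].
  split; first by rewrite size_map size_iota (leq_ltn_trans (leq_pred _)) // (leq_ltn_trans (leq_subr _ _)).
  rewrite -[block n _ j]/((fun k => block n (extend s0 w) k) j) -map_rcons.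
  have -> : rcons (iota i.+1 (j - i).-1) j = iota i.+1 (j - i).
    have d0 : 0 < j - i by rewrite subn_gt0.
    rewrite -[in RHS](prednK d0) -[X in _ = iota _ X]addn1 iotaD cats1 /=.
    by rewrite addSnnS prednK // subnKC // ltnW.
  have walk k : forall i', i' + k < t ->
      path (edge s0 P (n := n)) (block n (extend s0 w) i')
           [seq block n (extend s0 w) q | q <- iota i'.+1 k].
    elim: k => //= k IH i' lt.
    rewrite ed; last by apply: leq_ltn_trans lt; rewrite addnS ltnS leq_addr.
    by apply: IH; rewrite addSnnS.
  by apply: walk; rewrite subnKC // ltnW.
have bls_uniq w : w \in words s0 P (t * n) -> uniq (bls w).
  by move=> /bls_pw; apply: pairwise_uniq.
have inj : {in words s0 P (t * n) &, injective (fun w => [set b in bls w])}.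
  move=> w w' Lw Lw' /setP eqw.
  have eqb : bls w = bls w'.
    apply: (pairwise_eq r_asym (bls_pw _ Lw) (bls_pw _ Lw')).
    apply: uniq_perm; rewrite ?bls_uniq // => b.
    by have := eqw b; rewrite !inE.
  apply/ffunP => i.
  have lt : i %/ n < t by rewrite ltn_divLR.
  have lm : i %% n < n by rewrite ltn_mod.
  have := congr1 (fun s => nth (block n (extend s0 w) 0) s (i %/ n)) eqb.
  rewrite !(nth_map 0) ?size_iota // !nth_iota // !add0n => /ffunP/(_ (Ordinal lm)).
  rewrite !ffunE /= -divn_eq !(extendE _ _ (ltn_ord i)).
  by have -> : Ordinal (ltn_ord i) = i by apply: val_inj.
rewrite -(card_in_imset inj).
(* Each word yields a set of exactly [t] admissible blocks. The binomial coefficient times [t!] is a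
   falling factorial, hence at most the power. *)
apply: (@leq_trans ('C(#|words s0 P n|, t) * t`!)).
  rewrite leq_mul2r -cards_draws; apply/orP; right; apply: subset_leq_card.
  apply/subsetP => B /imsetP[w Lw ->]; rewrite inE; apply/andP; split.
    apply/subsetP => b; rewrite inE => /mapP[i]; rewrite mem_iota => /andP[_ lit ->].
    rewrite inE; apply/asbP.
    have lin : i * n + n <= t * n by rewrite -mulSnr leq_mul2r lit orbT.
    have := Lw; rewrite inE => /asbP; rewrite -{1}(subnKC lin) => /Psub.
    apply: Pext => j lj.
    by rewrite (extendE _ _ lj) ffunE.
  rewrite cardsE; apply/eqP.
  by have /card_uniqP -> := bls_uniq _ Lw; rewrite size_map size_iota.
rewrite bin_ffact.
elim: t {acyc bls r r_irr r_asym bls_pw bls_uniq inj} #|_| => // t IH M.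
case: M => // M.
rewrite ffactSS expnS leq_mul2l /=; apply: leq_trans (IH M) _.
by case: t {IH} => // t; rewrite leq_exp2r.
Qed.

(** Pair the factor [i + 1] of one factorial with [t - i] of the other: each product is at least
    [t]. This replaces Stirling's formula. *)
Lemma expn_leq_fact2 t : t ^ t <= t`! * t`!.
Proof.
have -> : t ^ t = \prod_(i < t) t by rewrite prod_nat_const card_ord.
have -> : t`! * t`! = \prod_(i < t) (i.+1 * (t - i)).
  rewrite big_split /= fact_prod big_add1 /= big_mkord; congr (_ * _).
  rewrite (reindex_inj rev_ord_inj) /=; apply: eq_bigr => i _.
  by rewrite subnSK.
apply: leq_prod => i _; have := ltn_ord i; move: (nat_of_ord i) => {}i lti.
rewrite mulSn -{1}(subnK (ltnW lti)) leq_add2l.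
by apply: leq_pmulr; rewrite subn_gt0.
Qed.

Lemma linear_leq_exp c : exists k0, forall k, k0 <= k -> c * k <= 2 ^ k.
Proof.
have lt m : m <= 2 ^ m by rewrite ltnW // ltn_expl.
exists (4 * c) => k /subnKC <-; elim: (k - _) => [|j IH].
  rewrite addn0 mulnCA; have -> : 4 * (c * c) = (2 * c) * (2 * c) by rewrite mulnACA.
  have -> : 4 * c = 2 * c + 2 * c by rewrite -mulnDl.
  by rewrite expnD leq_mul.
rewrite addnS expnS mulnS mul2n -addnn addnC leq_add //.
apply: leq_trans (lt c) _; rewrite leq_exp2l //.
by rewrite -[4 * c]/((1 + 3) * c) mulnDl mul1n -addnA leq_addr.
Qed.

(** With [p] words the second hypothesis reads [p <= c ^ (e / 2) * 2 ^ (- j * k / 2)]; squaring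
    keeps it in the integers. The counting bound at [t = 2 ^ k] divides by [t!], and
    [t! ^ 2 >= t ^ t = 2 ^ (t * k)] is one more unit of [j] at the new length [t * k]. *)
Lemma rate_step p q c j k e : q * (2 ^ k)`! <= p ^ (2 ^ k) ->
  p ^ 2 * 2 ^ (j * k) <= c ^ e ->
  q ^ 2 * 2 ^ (j.+1 * (2 ^ k * k)) <= c ^ (2 ^ k * e).
Proof.
set t := 2 ^ k => le1 le2.
have t0 : 0 < t by rewrite expn_gt0.
have -> : 2 ^ (j.+1 * (t * k)) = t ^ t * (2 ^ (j * k)) ^ t.
  by rewrite mulSn expnD -!expnM; congr (2 ^ _ * 2 ^ _); lia.
apply: (@leq_trans ((q * t`!) ^ 2 * (2 ^ (j * k)) ^ t)).
  rewrite mulnA leq_mul2r expnMn leq_mul2l; apply/orP; right; apply/orP; right.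
  by rewrite -mulnn; exact: expn_leq_fact2.
apply: (@leq_trans ((p ^ 2 * 2 ^ (j * k)) ^ t)).
  rewrite [in leqRHS]expnMn leq_mul2r -(expnM p 2 t) (mulnC 2) (expnM p t 2); apply/orP; right.
  by rewrite leq_exp2r.
by rewrite (mulnC t) (expnM c) leq_exp2r.
Qed.

(* Each failure to find a short cycle at length [a * k] lowers the growth rate
   of the number of words by the fixed factor [2 ^ (1 / (2 * a))], which cannot
   happen arbitrarily often. *)
Lemma short_cycle (S : finType) (s0 : S) P a k0 :
  prefix_pred P -> (forall n, exists x, P n x) -> 0 < a ->
  exists k, k0 <= k /\ exists x : nat -> S, exists p,
    [/\ 0 < p <= 2 ^ (2 * k), forall i, x (i + p) = x i &
       forall i, P (a * k) (sh i x)].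
Proof.
move=> prP neP a0; have [k1 k1P] := linear_leq_exp (2 * a).
apply: NNPP => noc.
have acyc k : maxn k0 k1 < k -> forall c, 0 < size c <= 2 ^ k + 2 ^ k ->
    ~~ cycle (edge s0 P (n := a * k)) c.
  move=> lek c /andP[c0 cle]; apply/negP => cc; apply: noc; exists k; split.
    by rewrite ltnW // (leq_ltn_trans _ lek) // leq_maxl.
  have ak0 : 0 < a * k by rewrite muln_gt0 a0 (leq_ltn_trans _ lek).
  have [x [xp xP]] := cycle_point prP ak0 c0 cc.
  exists x, (size c * (a * k)); split=> //.
  (* The period is [size c * (a * k) <= 2 ^ k * (2 * a * k)], and [2 * a * k <= 2 ^ k] by the choice
     of [k1]. *)
  rewrite muln_gt0 c0 ak0 /= mul2n -addnn expnD.
  apply: leq_trans (leq_mul cle (leqnn _)) _.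
  rewrite addnn -mul2n -mulnA mulnCA leq_mul2l mulnA k1P ?orbT //.
  by rewrite ltnW // (leq_ltn_trans _ lek) // leq_maxr.
have rate j : exists k, maxn k0 k1 < k /\
    #|words s0 P (a * k)| ^ 2 * 2 ^ (j * k) <= #|S| ^ (2 * a * k).
  elim: j => [|j [k [lek IH]]].
    exists (maxn k0 k1).+1; split=> //.
    rewrite mul0n expn0 muln1 -mulnA (mulnC 2) expnM leq_exp2r //.
    by rewrite (leq_trans (max_card _)) // card_ffun card_ord.
  exists (2 ^ k * k); split.
    by apply: leq_trans lek _; rewrite leq_pmull // expn_gt0.
  have ak0 : 0 < a * k by rewrite muln_gt0 a0 (leq_ltn_trans _ lek).
  have := rate_step (card_words_acyclic prP ak0 (acyc k lek)) IH.
  by have [-> ->] : 2 ^ k * (a * k) = a * (2 ^ k * k) /\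
      2 ^ k * (2 * a * k) = 2 * a * (2 ^ k * k) by lia.
(* For [j = #|S| ^ (2 * a)] the factor [2 ^ j] exceeds [#|S| ^ (2 * a)], so the rate bound would
   leave no word at all. *)
have [k [lek]] := rate (#|S| ^ (2 * a)).
apply/negP; rewrite -ltnNge.
have p0 : 0 < #|words s0 P (a * k)|.
  have [x Px] := neP (a * k); apply/card_gt0P; exists (block (a * k) x 0).
  rewrite inE; apply/asbP; apply: (prP.1) Px => i lti.
  by rewrite (extendE _ _ lti) ffunE.
have k0' : 0 < k by apply: leq_ltn_trans lek.
rewrite (expnM 2) (expnM _ (2 * a) k); apply: (@leq_trans ((2 ^ (#|S| ^ (2 * a))) ^ k)).
  by rewrite ltn_exp2r // ltn_expl.
by rewrite leq_pmull // expn_gt0 p0.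
Qed.

Lemma expnE_pow m n : m ^ n = Nat.pow m n.
Proof. by elim: n => //= n <-; rewrite expnS. Qed.

Definition sym_of_ord d (i : 'I_d) : sym d := exist _ (nat_of_ord i) (elimT ltP (ltn_ord i)).

Definition ord_of_sym d (s : sym d) : 'I_d := Ordinal (introT ltP (proj2_sig s)).

Lemma ord_of_symK d (s : sym d) : sym_of_ord (ord_of_sym s) = s.
Proof.
case: s => k lt; rewrite /sym_of_ord /=.
by congr exist; apply: Peano_dec.le_unique.
Qed.

Lemma short_periodic_point d (P : nat -> Sigma d -> Prop) a k0 :
  (forall n x y, agree n x y -> P n x -> P n y) ->
  (forall i n j x, P (i + n + j) x -> P n (shift_by i x)) ->
  (forall n, exists x, P n x) -> (0 < a)%coq_nat ->
  exists k x p, (k0 <= k)%coq_nat /\ ((1 <= p)%coq_nat /\ (p <= Nat.pow 2 (2 * k))%coq_nat) /\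
    shift_by p x = x /\ forall i, P (a * k) (shift_by i x).
Proof.
move=> Pext Psub neP /ltP a0.
pose cv (x : nat -> 'I_d) : Sigma d := fun n => sym_of_ord (x n).
have [x0 _] := neP 0.
have prP : prefix_pred (fun n x => P n (cv x)).
  split; last by move=> i n j x /Psub.
  by move=> n x y xy; apply: Pext => i /ltP lti; rewrite /cv xy.
have neP' n : exists x, P n (cv x).
  have [x Px] := neP n; exists (fun i => ord_of_sym (x i)).
  by apply: Pext Px => i _; rewrite /cv ord_of_symK.
have [k [lek [x [p [/andP[p0 lep] xp xP]]]]] :=
  short_cycle (ord_of_sym (x0 0)) k0 prP neP' a0.
exists k, (cv x), p; split; first exact/leP.
split; first by split; apply/leP => //; rewrite -expnE_pow.
split=> //; apply: functional_extensionality => i.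
by rewrite /shift_by /cv -[in RHS]xp addnC.
Qed.

End Combinatorics.

(** * Birkhoff sums and sub-actions *)

Lemma Rabs_le_bounds a b : Rabs a <= b -> - b <= a <= b.
Proof. unfold Rabs; destruct (Rcase_abs a); lra. Qed.

(** The case [n = 0] is included, so [C] also bounds the oscillation. *)
Definition holder {d} (th C : R) (A : Sigma d -> R) : Prop :=
  0 <= C /\ forall n x y, agree n x y -> Rabs (A x - A y) <= C * th ^ n.

Fixpoint bsum {d} (A : Sigma d -> R) (n : nat) (x : Sigma d) : R :=
  match n with
  | O => 0
  | S m => A x + bsum A m (shift x)
  end.

Lemma shift_by_0 {d} (x : Sigma d) : shift_by 0 x = x.
Proof. reflexivity. Qed.

Lemma shift_by_shift {d} i (x : Sigma d) : shift_by i (shift x) = shift_by (S i) x.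
Proof. reflexivity. Qed.

Lemma shift_shift_by {d} i (x : Sigma d) : shift (shift_by i x) = shift_by (S i) x.
Proof.
  apply functional_extensionality; intro n; unfold shift, shift_by; f_equal; lia.
Qed.

Lemma shift_by_add {d} i j (x : Sigma d) : shift_by i (shift_by j x) = shift_by (j + i) x.
Proof.
  apply functional_extensionality; intro n; unfold shift_by; f_equal; lia.
Qed.

Lemma shift_by_mul {d} p (x : Sigma d) (hp : shift_by p x = x) q : shift_by (q * p) x = x.
Proof.
  induction q as [|q IH]; [reflexivity|].
  simpl; rewrite <- shift_by_add, hp; exact IH.
Qed.

Lemma shift_by_mod {d} p (x : Sigma d) (hp : shift_by p x = x) i :
  (1 <= p)%nat -> shift_by i x = shift_by (i mod p) x.
Proof.
  intro h1.
  rewrite (Nat.div_mod_eq i p) at 1.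
  rewrite <- shift_by_add, (Nat.mul_comm p), shift_by_mul; auto.
Qed.

Lemma iter_shift {d} i (x : Sigma d) : Nat.iter i shift x = shift_by i x.
Proof.
  induction i as [|i IH]; [reflexivity|].
  simpl; rewrite IH; apply shift_shift_by.
Qed.

Lemma same_eq {d} (x y : Sigma d) : same x y -> x = y.
Proof. exact (functional_extensionality x y). Qed.

Lemma agree_sym {d} n (x y : Sigma d) : agree n x y -> agree n y x.
Proof. intros h k hk; symmetry; auto. Qed.

Lemma agree_trans {d} n (x y z : Sigma d) : agree n x y -> agree n y z -> agree n x z.
Proof. intros h h' k hk; rewrite h, h'; auto. Qed.

Lemma agree_le {d} m n (x y : Sigma d) : (m <= n)%nat -> agree n x y -> agree m x y.
Proof. intros h h' k hk; apply h'; lia. Qed.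

Lemma agree_shift_by {d} i n (x y : Sigma d) :
  agree (i + n) x y -> agree n (shift_by i x) (shift_by i y).
Proof. intros h k hk; apply h; lia. Qed.

Lemma agree_add {d} i n (x y : Sigma d) :
  agree i x y -> agree n (shift_by i x) (shift_by i y) -> agree (i + n) x y.
Proof.
  intros h h' k hk; destruct (Nat.lt_ge_cases k i) as [l|l]; [auto|].
  replace k with (i + (k - i))%nat by lia; apply (h' (k - i)%nat); lia.
Qed.

Lemma agree_all_eq {d} (x y : Sigma d) : (forall n, agree n x y) -> x = y.
Proof. intro h; apply same_eq; intro n; apply (h (S n)); lia. Qed.

Lemma bsum_add {d} (A : Sigma d -> R) m n x :
  bsum A (m + n) x = bsum A m x + bsum A n (shift_by m x).
Proof.
  revert x; induction m as [|m IH]; intro x; simpl; [rewrite shift_by_0; ring|].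
  rewrite IH, shift_by_shift; ring.
Qed.

Lemma bsum_le {d} (A B : Sigma d -> R) n x :
  (forall i, (i < n)%nat -> A (shift_by i x) <= B (shift_by i x)) ->
  bsum A n x <= bsum B n x.
Proof.
  revert x; induction n as [|n IH]; intros x h; simpl; [lra|].
  apply Rplus_le_compat; [apply (h 0%nat); lia|].
  apply IH; intros i hi; rewrite shift_by_shift; apply h; lia.
Qed.

Lemma bsum_const {d} c n (x : Sigma d) : bsum (fun _ => c) n x = INR n * c.
Proof.
  revert x; induction n as [|n IH]; intro x; [simpl; ring|].
  rewrite S_INR; simpl; rewrite IH; ring.
Qed.

Lemma bsum_plus {d} (A B : Sigma d -> R) n x :
  bsum (fun y => A y + B y) n x = bsum A n x + bsum B n x.
Proof.
  revert x; induction n as [|n IH]; intro x; simpl; [ring|rewrite IH; ring].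
Qed.

Lemma bsum_opp {d} (A : Sigma d -> R) n x : bsum (fun y => - A y) n x = - bsum A n x.
Proof.
  revert x; induction n as [|n IH]; intro x; simpl; [ring|rewrite IH; ring].
Qed.

Lemma bsum_ext {d} (A B : Sigma d -> R) n x :
  (forall y, A y = B y) -> bsum A n x = bsum B n x.
Proof. intro h; apply Rle_antisym; apply bsum_le; intros; rewrite h; lra. Qed.

Lemma bsum_coboundary {d} (u : Sigma d -> R) n x :
  bsum (fun y => u y - u (shift y)) n x = u x - u (shift_by n x).
Proof.
  revert x; induction n as [|n IH]; intro x; simpl; [rewrite shift_by_0; ring|].
  rewrite IH, shift_by_shift; ring.
Qed.

Lemma bsum_le_const {d} (A : Sigma d -> R) c n x :
  (forall i, (i < n)%nat -> A (shift_by i x) <= c) -> bsum A n x <= INR n * c.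
Proof. intro h; rewrite <- (bsum_const c n x); apply bsum_le; exact h. Qed.

Lemma bsum_ge_const {d} (A : Sigma d -> R) c n x :
  (forall i, (i < n)%nat -> c <= A (shift_by i x)) -> INR n * c <= bsum A n x.
Proof. intro h; rewrite <- (bsum_const c n x); apply bsum_le; exact h. Qed.

Lemma bsum_periodic {d} (A : Sigma d -> R) p x (hp : shift_by p x = x) q :
  bsum A (q * p) x = INR q * bsum A p x.
Proof.
  induction q as [|q IH]; [simpl; ring|].
  rewrite S_INR; simpl; rewrite bsum_add, hp, IH; ring.
Qed.

Lemma bsum_rotate {d} (A : Sigma d -> R) p x (hp : shift_by p x = x) i :
  bsum A p (shift_by i x) = bsum A p x.
Proof.
  pose proof (bsum_add A i p x) as h1; pose proof (bsum_add A p i x) as h2.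
  rewrite Nat.add_comm, h2, hp in h1; lra.
Qed.

(** * Geometric series and Hölder functions *)

Lemma geom_pos th n : 0 < th < 1 -> 0 < th ^ n.
Proof. intro h; apply pow_lt; lra. Qed.

Lemma geom_le th m n : 0 < th < 1 -> (m <= n)%nat -> th ^ n <= th ^ m.
Proof.
  intros h hmn; replace n with (m + (n - m))%nat by lia; rewrite pow_add.
  pose proof (geom_pos th m h).
  assert (th ^ (n - m) <= 1) by (rewrite <- (pow1 (n - m)); apply pow_incr; lra).
  nra.
Qed.

Lemma geom_small th c : 0 < th < 1 -> 0 < c -> exists n, th ^ n < c.
Proof.
  intros h hc; destruct (pow_lt_1_zero th) with (y := c) as [n hn]; auto.
  - rewrite Rabs_right; lra.
  - exists n; specialize (hn n (le_n n)); rewrite Rabs_right in hn; auto.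
    pose proof (geom_pos th n h); lra.
Qed.

(** After [i] steps the points still agree on [n + k - i] symbols, so the differences sum to a
    geometric series. The induction carries the missing tail [th ^ (n + k)], which absorbs each new
    term. *)
Lemma distortion {d} th C (A : Sigma d -> R) n k x y :
  0 < th < 1 -> holder th C A -> agree (n + k) x y ->
  Rabs (bsum A n x - bsum A n y) <= C / (1 - th) * th ^ k.
Proof.
  intros hth [hC hA]; revert x y.
  assert (hq : 0 <= C / (1 - th)) by (apply Rmult_le_pos; [|left; apply Rinv_0_lt_compat]; lra).
  assert (key : forall x y, agree (n + k) x y ->
    Rabs (bsum A n x - bsum A n y) <= C / (1 - th) * (th ^ k - th ^ (n + k))).
  { induction n as [|n IH]; intros x y hxy.
    - simpl; rewrite Rminus_diag, Rabs_R0; simpl; lra.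
    - simpl bsum.
      replace (A x + bsum A n (shift x) - (A y + bsum A n (shift y)))
        with ((A x - A y) + (bsum A n (shift x) - bsum A n (shift y))) by ring.
      eapply Rle_trans; [apply Rabs_triang|].
      pose proof (hA _ _ _ hxy).
      assert (hs : agree (n + k) (shift x) (shift y))
        by (apply (agree_shift_by 1 (n + k)); exact hxy).
      specialize (IH _ _ hs).
      replace (S n + k)%nat with (S (n + k)) in * by lia; simpl pow in *.
      replace (C / (1 - th) * (th ^ k - th * th ^ (n + k))) with
        (C / (1 - th) * (th ^ k - th ^ (n + k)) + C * th ^ (n + k)) by (field; lra).
      pose proof (geom_pos th (n + k) hth).
      assert (C * (th * th ^ (n + k)) <= C * th ^ (n + k)) by (apply Rmult_le_compat_l; [lra|nra]).
      lra. }
  intros x y hxy; eapply Rle_trans; [apply key; exact hxy|].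
  apply Rmult_le_compat_l; auto; pose proof (geom_pos th (n + k) hth); lra.
Qed.

Lemma holder_plus {d} th C1 C2 (A B : Sigma d -> R) :
  holder th C1 A -> holder th C2 B -> holder th (C1 + C2) (fun x => A x + B x).
Proof.
  intros [h1 hA] [h2 hB]; split; [lra|]; intros n x y hxy.
  replace (A x + B x - (A y + B y)) with ((A x - A y) + (B x - B y)) by ring.
  eapply Rle_trans; [apply Rabs_triang|].
  specialize (hA _ _ _ hxy); specialize (hB _ _ _ hxy); lra.
Qed.

Lemma holder_scal {d} th C c (A : Sigma d -> R) :
  holder th C A -> holder th (Rabs c * C) (fun x => c * A x).
Proof.
  intros [h1 hA]; split; [apply Rmult_le_pos; [apply Rabs_pos|lra]|]; intros n x y hxy.
  replace (c * A x - c * A y) with (c * (A x - A y)) by ring; rewrite Rabs_mult, Rmult_assoc.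
  apply Rmult_le_compat_l; [apply Rabs_pos|auto].
Qed.

Lemma holder_const {d} th c : holder (d := d) th 0 (fun _ => c).
Proof. split; [lra|]; intros; rewrite Rminus_diag, Rabs_R0; lra. Qed.

Lemma holder_shift {d} th C (A : Sigma d -> R) : 0 < th < 1 ->
  holder th C A -> holder th (C / th) (fun x => A (shift x)).
Proof.
  intros hth [h1 hA]; split; [apply Rmult_le_pos; [|left; apply Rinv_0_lt_compat]; lra|].
  intros n x y hxy.
  destruct n as [|n].
  - eapply Rle_trans; [apply (hA 0%nat); intros k hk; lia|]; simpl.
    apply Rmult_le_compat_r; [lra|].
    rewrite <- (Rmult_1_r C) at 1; apply Rmult_le_compat_l; [lra|].
    rewrite <- Rinv_1; apply Rinv_le_contravar; lra.
  - eapply Rle_trans; [apply (hA n), (agree_shift_by 1 n); exact hxy|].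
    right; simpl; field; lra.
Qed.

Lemma holder_osc {d} th C (A : Sigma d -> R) x y : holder th C A -> A x - A y <= C.
Proof.
  intros [h1 hA]; specialize (hA 0%nat x y); simpl in hA.
  assert (Rabs (A x - A y) <= C) by (rewrite <- (Rmult_1_r C); apply hA; intros k hk; lia).
  apply Rabs_le_bounds in H; lra.
Qed.

(** * Sub-actions and the critical value *)

Definition glue {d} (n : nat) (y x : Sigma d) : Sigma d :=
  fun i => if Nat.ltb i n then y i else x (i - n)%nat.

Lemma glue_agree {d} n (y x : Sigma d) : agree n (glue n y x) y.
Proof.
  intros k hk; unfold glue; apply Nat.ltb_lt in hk; rewrite hk; reflexivity.
Qed.

Lemma glue_shift {d} n (y x : Sigma d) : shift_by n (glue n y x) = x.
Proof.
  apply functional_extensionality; intro k; unfold shift_by, glue.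
  replace (Nat.ltb (n + k) n) with false by (symmetry; apply Nat.ltb_ge; lia).
  f_equal; lia.
Qed.

(** [v x] is the supremum of the sums over all finite pasts of [x], the empty one included. A past
    of [x] followed by [x] is a past of [shift x], which gives the inequality. Gluing a past of [x]
    onto a nearby [y] changes its sum by the distortion only, which gives the regularity. *)
Lemma subaction {d} th C B (A : Sigma d -> R) :
  0 < th < 1 -> holder th C A -> (forall n x, bsum A n x <= B) ->
  exists v, holder th (C / (1 - th)) v /\ forall x, A x + v x - v (shift x) <= 0.
Proof.
  intros hth hA hB.
  pose (E := fun x r => exists n y, shift_by n y = x /\ r = bsum A n y).
  assert (hlub : forall x, exists v, is_lub (E x) v).
  { intro x; destruct (completeness (E x)) as [v hv].
    - exists B; intros r [n [y [_ ->]]]; apply hB.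
    - exists 0, 0%nat, x; split; reflexivity.
    - exists v; exact hv. }
  pose (v := fun x => epsilon (inhabits 0) (is_lub (E x))).
  assert (hv : forall x, is_lub (E x) (v x)) by (intro x; apply epsilon_spec, hlub).
  assert (hC : 0 <= C / (1 - th)).
  { destruct hA; apply Rmult_le_pos; [|left; apply Rinv_0_lt_compat]; lra. }
  exists v; split.
  - split; [exact hC|].
    assert (half : forall n x y, agree n x y -> v x <= v y + C / (1 - th) * th ^ n).
    { intros n x y hxy; apply (hv x); intros r [m [z [<- ->]]].
      assert (hz : agree (m + n) z (glue m z y)).
      { apply agree_add; [apply agree_sym, glue_agree|rewrite glue_shift; exact hxy]. }
      pose proof (distortion th C A m n _ _ hth hA hz) as hd.
      assert (bsum A m (glue m z y) <= v y)
        by (apply (hv y); exists m, (glue m z y); split; [apply glue_shift|reflexivity]).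
      apply Rabs_le_bounds in hd; lra. }
    intros n x y hxy; apply Rabs_le.
    pose proof (half n x y hxy); pose proof (half n y x (agree_sym _ _ _ hxy)); lra.
  - intro x.
    assert (v x <= v (shift x) - A x); [|lra].
    apply (hv x); intros r [n [y [hy ->]]].
    assert (bsum A (n + 1) y <= v (shift x)).
    { apply (hv (shift x)); exists (n + 1)%nat, y; split; [|reflexivity].
      rewrite Nat.add_1_r, <- shift_shift_by, hy; reflexivity. }
    rewrite bsum_add, hy in H; simpl in H; lra.
Qed.

Definition periodize {d} (n : nat) (x : Sigma d) : Sigma d := fun i => x (i mod n)%nat.

Lemma periodize_agree {d} n (x : Sigma d) : agree n (periodize n x) x.
Proof. intros k hk; unfold periodize; rewrite Nat.mod_small; auto. Qed.

Lemma periodize_period {d} n (x : Sigma d) : shift_by n (periodize n x) = periodize n x.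
Proof.
  apply functional_extensionality; intro k; unfold shift_by, periodize; f_equal.
  destruct n as [|n]; [reflexivity|].
  rewrite <- (Nat.mul_1_l (S n)) at 1; rewrite Nat.add_comm; apply Nat.Div0.mod_add.
Qed.

Lemma linear_growth (a b B : R) : (forall q : nat, INR q * a <= INR q * b + B) -> a <= b.
Proof.
  intro h; apply Rnot_lt_le; intro hlt.
  destruct (archimed_cor1 ((a - b) / (Rabs B + 1))) as [N [hN hN0]].
  { apply Rmult_lt_0_compat; [lra|apply Rinv_0_lt_compat; pose proof (Rabs_pos B); lra]. }
  specialize (h N).
  assert (h0 : 0 < INR N) by (apply lt_0_INR; auto).
  pose proof (Rabs_pos B); pose proof (Rle_abs B).
  apply (Rmult_lt_compat_l (INR N * (Rabs B + 1))) in hN; [|nra].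
  replace (INR N * (Rabs B + 1) * / INR N) with (Rabs B + 1) in hN by (field; lra).
  replace (INR N * (Rabs B + 1) * ((a - b) / (Rabs B + 1))) with (INR N * (a - b)) in hN
    by (field; lra).
  lra.
Qed.

(* [m] is the critical value: the infimum of the slopes for which the Birkhoff
   sums stay bounded above; closing an orbit shows that it is attained. *)
Lemma critical_value {d} th C M (A : Sigma d -> R) (x0 : Sigma d) :
  0 < th < 1 -> holder th C A -> (forall x, Rabs (A x) <= M) ->
  exists m, (forall n x, bsum A n x <= INR n * m + C / (1 - th)) /\
    forall e B, 0 < e -> exists n x, INR n * (m - e) + B < bsum A n x.
Proof.
  intros hth hA hM.
  (* Slopes enter negated because [completeness] produces suprema; the critical value is [- m]. *)
  pose (E := fun m => exists B, forall n x, bsum A n x <= INR n * (- m) + B).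
  destruct (completeness E) as [m hm].
  - exists M; intros m [B hB].
    enough (- M <= - m) by lra.
    apply linear_growth with B; intro q; eapply Rle_trans; [|apply (hB q x0)].
    apply bsum_ge_const; intros i _; specialize (hM (shift_by i x0)).
    apply Rabs_le_bounds in hM; lra.
  - exists (- M), 0; intros n x; rewrite Rplus_0_r; apply bsum_le_const; intros i _.
    specialize (hM (shift_by i x)); apply Rabs_le_bounds in hM; lra.
  - exists (- m); split.
    (* The sum over a period recurs, so every slope with bounded sums dominates the average along
       [z] without error term. Passing back to [x] costs the distortion once. *)
    + intros n x; pose (z := periodize n x).
      assert (hz : bsum A n z <= INR n * - m).
      { enough (INR n * m <= - bsum A n z) by lra.
        destruct n as [|n]; [simpl; lra|].
        assert (hn : 0 < INR (S n)) by (apply lt_0_INR; lia).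
        enough (m <= - bsum A (S n) z / INR (S n)).
        { apply (Rmult_le_compat_l (INR (S n))) in H; [|lra].
          replace (INR (S n) * (- bsum A (S n) z / INR (S n))) with (- bsum A (S n) z) in H
            by (field; lra). exact H. }
        apply (proj2 hm); intros m' [B hB].
        enough (bsum A (S n) z <= INR (S n) * - m').
        { apply (Rmult_le_reg_l (INR (S n))); [lra|].
          replace (INR (S n) * (- bsum A (S n) z / INR (S n))) with (- bsum A (S n) z)
            by (field; lra). lra. }
        apply linear_growth with B; intro q.
        specialize (hB (q * S n)%nat z); rewrite bsum_periodic in hB
          by apply periodize_period.
        rewrite mult_INR in hB; lra. }
      assert (hd : Rabs (bsum A n x - bsum A n z) <= C / (1 - th) * th ^ 0).
      { apply distortion; auto; rewrite Nat.add_0_r; apply agree_sym, periodize_agree. }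
      apply Rabs_le_bounds in hd; simpl in hd; lra.
    + intros e B he; apply NNPP; intro hn.
      assert (hE : E (m + e)).
      { exists B; intros n x; apply Rnot_lt_le; intro hlt; apply hn; exists n, x.
        replace (- m - e) with (- (m + e)) by ring; exact hlt. }
      apply hm in hE; lra.
Qed.

(** If every block of length [n] lost at least [e], all sums would grow with slope at most
    [m - e / n] up to a constant, against the criticality of [m]. *)
Lemma near_maximal_orbits {d} th C M (A : Sigma d -> R) (x0 : Sigma d) :
  0 < th < 1 -> holder th C A -> (forall x, Rabs (A x) <= M) ->
  exists m u C', holder th C' u /\
    (forall x, A x - m + u x - u (shift x) <= 0) /\
    forall n e, 0 < e -> exists x, forall i, (i < n)%nat ->
      - e <= A (shift_by i x) - m + u (shift_by i x) - u (shift (shift_by i x)).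
Proof.
  intros hth hA hM.
  destruct (critical_value th C M A x0 hth hA hM) as [m [hm1 hm2]].
  assert (hAm : holder th C (fun x => A x + - m)).
  { rewrite <- (Rplus_0_r C); apply holder_plus; [exact hA|apply holder_const]. }
  assert (hsum : forall n x, bsum (fun x => A x + - m) n x = bsum A n x - INR n * m).
  { intros n x; rewrite bsum_plus, bsum_const; ring. }
  destruct (subaction th C (C / (1 - th)) _ hth hAm) as [u [hu hsub]].
  { intros n x; rewrite hsum; specialize (hm1 n x); lra. }
  exists m, u, (C / (1 - th)); split; [exact hu|split].
  { intro x; specialize (hsub x); lra. }
  intros n e he; apply NNPP; intro hno.
  set (Ab := fun x => (A x + - m) + (u x - u (shift x))).
  assert (hneg : forall x, Ab x <= 0) by (intro x; unfold Ab; specialize (hsub x); lra).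
  assert (hblock : forall x, bsum Ab n x <= - e).
  { intro x; apply Rnot_lt_le; intro hlt; apply hno; exists x; intros i hi.
    apply Rnot_lt_le; intro hi2.
    assert (hs : bsum Ab n x <= - e); [|lra].
    replace n with (i + (1 + (n - i - 1)))%nat by lia.
    rewrite !bsum_add.
    assert (bsum Ab i x <= INR i * 0) by (apply bsum_le_const; auto).
    assert (bsum Ab (n - i - 1) (shift_by 1 (shift_by i x)) <= INR (n - i - 1) * 0)
      by (apply bsum_le_const; auto).
    simpl bsum at 2; unfold Ab at 2; lra. }
  assert (hn1 : (1 <= n)%nat).
  { destruct n; [|lia]. specialize (hblock x0); simpl in hblock; lra. }
  assert (hlong : forall q x, bsum Ab (q * n) x <= - INR q * e).
  { induction q as [|q IH]; intro x; [simpl; lra|].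
    rewrite S_INR; simpl; rewrite bsum_add.
    specialize (IH (shift_by n x)); specialize (hblock x); lra. }
  assert (hn0 : 0 < INR n) by (apply lt_0_INR; lia).
  (* In the additive constant, [e] pays for the incomplete last block and [C / (1 - th)] for the
     oscillation of [u]. *)
  destruct (hm2 (e / INR n) (e + C / (1 - th))) as [N [x hx]].
  { apply Rmult_lt_0_compat; [lra|apply Rinv_0_lt_compat; lra]. }
  assert (h1 : bsum Ab N x = (bsum A N x - INR N * m) + (u x - u (shift_by N x))).
  { rewrite <- hsum, <- bsum_coboundary; apply bsum_plus. }
  pose proof (holder_osc th _ u (shift_by N x) x hu) as h2.
  assert (h3 : bsum Ab N x <= - INR (N / n) * e).
  { rewrite (Nat.div_mod_eq N n) at 1; rewrite Nat.mul_comm, bsum_add.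
    specialize (hlong (N / n)%nat x).
    assert (bsum Ab (N mod n) (shift_by (N / n * n) x) <= INR (N mod n) * 0)
      by (apply bsum_le_const; auto).
    lra. }
  assert (h4 : INR N * (e / INR n) <= INR (N / n) * e + e).
  { assert (hN : INR N <= INR n * (INR (N / n) + 1)).
    { rewrite <- S_INR, <- mult_INR; apply le_INR.
      pose proof (Nat.div_mod_eq N n); pose proof (Nat.mod_upper_bound N n); lia. }
    apply (Rmult_le_compat_r (e / INR n)) in hN.
    - replace (INR n * (INR (N / n) + 1) * (e / INR n)) with (INR (N / n) * e + e) in hN
        by (field; lra). exact hN.
    - apply Rmult_le_pos; [lra|left; apply Rinv_0_lt_compat; lra]. }
  lra.
Qed.

(** * Periodic orbits of small defect and large gap *)

Fixpoint code {d} (n : nat) (x : Sigma d) : nat :=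
  match n with
  | O => 0%nat
  | S m => (code m x * d + proj1_sig (x m))%nat
  end.

Lemma code_lt {d} n (x : Sigma d) : (code n x < d ^ n)%nat.
Proof.
  induction n as [|n IH]; simpl; [lia|].
  pose proof (proj2_sig (x n)); simpl in *.
  assert (S (code n x) * d <= d ^ n * d)%nat by (apply Nat.mul_le_mono_r; lia).
  rewrite (Nat.mul_comm d); lia.
Qed.

Lemma code_inj {d} n (x y : Sigma d) : code n x = code n y -> agree n x y.
Proof.
  induction n as [|n IH]; intros h k hk; [lia|]; simpl in h.
  pose proof (proj2_sig (x n)); pose proof (proj2_sig (y n)); simpl in *.
  assert (h1 : code n x = code n y) by nia.
  destruct (Nat.eq_dec k n) as [->|hkn]; [|apply IH; auto; lia].
  rewrite h1 in h; assert (h2 : proj1_sig (x n) = proj1_sig (y n)) by lia.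
  destruct (x n) as [a ha], (y n) as [b hb]; simpl in h2; subst b.
  f_equal; apply Peano_dec.le_unique.
Qed.

Lemma code_agree {d} n (x y : Sigma d) : agree n x y -> code n x = code n y.
Proof.
  induction n as [|n IH]; intro h; [reflexivity|]; simpl.
  rewrite (IH (agree_le n (S n) _ _ (le_S _ _ (le_n n)) h)), (h n); auto.
Qed.

(** A finite form of compactness: a candidate that fails at some [e0] fails at all smaller [e], so
    the remaining candidates have to serve there. *)
Lemma pigeonhole_small (Q : nat -> R -> Prop) N :
  (forall c e e', Q c e -> e <= e' -> Q c e') ->
  (forall e, 0 < e -> exists c, (c < N)%nat /\ Q c e) ->
  exists c, (c < N)%nat /\ forall e, 0 < e -> Q c e.
Proof.
  intro mono; induction N as [|N IH]; intro h.
  - destruct (h 1) as [c [hc _]]; [lra|lia].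
  - destruct (classic (forall e, 0 < e -> Q N e)) as [hN|hN].
    { exists N; split; [lia|exact hN]. }
    apply not_all_ex_not in hN; destruct hN as [e0 hN].
    apply imply_to_and in hN; destruct hN as [he0 hN].
    destruct IH as [c [hc hQ]]; [|exists c; split; [lia|exact hQ]].
    intros e he; destruct (h (Rmin e e0)) as [c [hc hQ]]; [apply Rmin_glb_lt; auto|].
    exists c; split.
    + destruct (Nat.eq_dec c N) as [->|]; [|lia].
      exfalso; apply hN; apply mono with (1 := hQ), Rmin_r.
    + apply mono with (1 := hQ), Rmin_l.
Qed.

(** As [2 ^ k] bounds the period, [Q ^ k] stands for an arbitrary power of it. *)
Lemma cheap_orbit {d} th C Q e0 (A : Sigma d -> R) :
  0 < th < 1 -> holder th C A -> 1 <= Q -> 0 < e0 ->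
  (forall n e, 0 < e -> exists x, forall i, (i < n)%nat -> - e <= A (shift_by i x)) ->
  exists k x p c, (1 <= p <= 2 ^ k)%nat /\ shift_by p x = x /\
    - bsum A p x <= c /\ 0 < c /\ c * Q ^ k <= e0.
Proof.
  intros hth [hC hA] hQ he0 hmax.
  (* Words realized with defect at most [e] per point for every [e], so the language does not depend
     on [e]. It has words of every length because there are finitely many codes to choose from. *)
  pose (P := fun n (x : Sigma d) => forall e, 0 < e -> exists y, agree n y x /\
    forall i, (i < n)%nat -> - e <= A (shift_by i y)).
  assert (Pext : forall n x y, agree n x y -> P n x -> P n y).
  { intros n x y hxy hP e he; destruct (hP e he) as [z [hz hz']].
    exists z; split; [eapply agree_trans; eauto|exact hz']. }
  assert (Psub : forall i n j x, P (i + n + j)%nat x -> P n (shift_by i x)).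
  { intros i n j x hP e he; destruct (hP e he) as [z [hz hz']].
    exists (shift_by i z); split.
    - apply agree_shift_by; eapply agree_le; [|exact hz]; lia.
    - intros l hl; rewrite shift_by_add; apply hz'; lia. }
  assert (Pne : forall n, exists x, P n x).
  { intro n.
    destruct (pigeonhole_small (fun c e => exists x, code n x = c /\
      forall i, (i < n)%nat -> - e <= A (shift_by i x)) (d ^ n)) as [c [_ hc]].
    - intros c e e' [x [hx hx']] hee; exists x; split; auto.
      intros i hi; specialize (hx' i hi); lra.
    - intros e he; destruct (hmax n e he) as [x hx].
      exists (code n x); split; [apply code_lt|exists x; auto].
    - destruct (hc 1) as [x [hx _]]; [lra|].
      exists x; intros e he; destruct (hc e he) as [y [hy hy']].
      exists y; split; auto; apply code_inj; congruence. }
  assert (Plow : forall n x, P n x -> (1 <= n)%nat -> - (C * th ^ n) <= A x).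
  { intros n x hP hn; apply Rnot_lt_le; intro hlt.
    destruct (hP ((- (C * th ^ n) - A x) / 2)) as [y [hy hy']]; [lra|].
    specialize (hy' 0%nat ltac:(lia)); rewrite shift_by_0 in hy'.
    specialize (hA n y x hy); apply Rabs_le_bounds in hA; lra. }
  (* This gives [4 * th ^ a * Q ^ 2 <= / 2], where [4] comes from the period bound [2 ^ (2 * k)] and
     [Q ^ 2] from [Q ^ (2 * k)]. Then [k0] makes the remaining power of [/ 2] beat [C + 1]; the
     [+ 1] keeps the cost positive. *)
  destruct (geom_small th (/ (8 * Q ^ 2)) hth) as [a ha].
  { apply Rinv_0_lt_compat; assert (0 < Q ^ 2) by (apply pow_lt; lra); lra. }
  destruct (geom_small (/ 2) (e0 / (C + 1))) as [k0 hk0]; [lra| |].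
  { apply Rmult_lt_0_compat; [lra|apply Rinv_0_lt_compat; lra]. }
  assert (ha0 : (0 < a)%nat).
  { destruct a; [|lia]; exfalso; simpl in ha.
    assert (1 <= Q ^ 2) by (apply pow_R1_Rle; lra).
    assert (/ (8 * Q ^ 2) <= / 1) by (apply Rinv_le_contravar; simpl in *; lra).
    simpl in *; lra. }
  (* [S k0] forces [k >= 1], so that the windows are not empty and [Plow] applies. *)
  destruct (@Combinatorics.short_periodic_point d P a (S k0) Pext Psub Pne ha0)
    as [k [x [p [hk [hp [hx hP]]]]]].
  change (ssrnat.muln 2 k) with (2 * k)%nat in hp.
  change (ssrnat.muln a k) with (a * k)%nat in hP.
  assert (hck : 0 < (2 ^ (2 * k)) * ((C + 1) * th ^ (a * k))).
  { pose proof (geom_pos th (a * k) hth); assert (0 < 2 ^ (2 * k)) by (apply pow_lt; lra).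
    apply Rmult_lt_0_compat; [lra|apply Rmult_lt_0_compat; lra]. }
  exists (2 * k)%nat, x, p, ((2 ^ (2 * k)) * ((C + 1) * th ^ (a * k))).
  split; [exact hp|split; [exact hx|split; [|split; [exact hck|]]]].
  - rewrite <- bsum_opp.
    eapply Rle_trans; [apply bsum_le_const with (c := (C + 1) * th ^ (a * k))|].
    + intros i _; specialize (Plow _ _ (hP i) ltac:(nia)).
      pose proof (geom_pos th (a * k) hth); nra.
    + apply Rmult_le_compat_r.
      * pose proof (geom_pos th (a * k) hth); nra.
      * change 2 with (INR 2); rewrite <- pow_INR; apply le_INR; lia.
  - rewrite !pow_mult.
    replace ((2 ^ 2) ^ k * ((C + 1) * (th ^ a) ^ k) * (Q ^ 2) ^ k)
      with ((C + 1) * (4 * th ^ a * Q ^ 2) ^ k)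
      by (rewrite !Rpow_mult_distr; replace (2 ^ 2) with 4 by ring; ring).
    assert (hb : 0 <= 4 * th ^ a * Q ^ 2 <= / 2).
    { pose proof (geom_pos th a hth); assert (hq : 0 < Q ^ 2) by (apply pow_lt; lra).
      split; [apply Rmult_le_pos; lra|].
      apply (Rmult_lt_compat_r (4 * Q ^ 2)) in ha; [|lra].
      replace (/ (8 * Q ^ 2) * (4 * Q ^ 2)) with (/ 2) in ha by (field; lra). lra. }
    assert ((4 * th ^ a * Q ^ 2) ^ k <= (/ 2) ^ k) by (apply pow_incr; exact hb).
    assert ((/ 2) ^ k <= (/ 2) ^ k0) by (apply geom_le; [lra|lia]).
    apply (Rmult_le_reg_l (/ (C + 1))); [apply Rinv_0_lt_compat; lra|].
    rewrite <- Rmult_assoc, Rinv_l, Rmult_1_l by lra.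
    unfold Rdiv in hk0; lra.
Qed.

(** The return makes [x] itself [l]-periodic on its first [l + n] symbols, not only on the first
    [l]. The extra [n] symbols supply the factor [th ^ n] in the distortion. *)
Lemma periodize_agree_long {d} l n (x : Sigma d) : (1 <= l)%nat ->
  agree n x (shift_by l x) -> agree (l + n) (periodize l x) x.
Proof.
  intros hl h k; induction k as [k IH] using lt_wf_ind; intro hk.
  destruct (Nat.lt_ge_cases k l) as [hkl|hkl]; [apply periodize_agree; auto|].
  specialize (IH (k - l)%nat ltac:(lia) ltac:(lia)).
  replace k with (l + (k - l))%nat at 1 by lia.
  change (periodize l x (l + (k - l))%nat) with (shift_by l (periodize l x) (k - l)%nat).
  rewrite periodize_period, IH, h by lia; unfold shift_by; f_equal; lia.
Qed.

Definition gap {d} (g : nat) (x : Sigma d) : Prop :=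
  forall i j, agree (g + 1) (shift_by i x) (shift_by j x) -> shift_by i x = shift_by j x.

(** The two times split the periodic orbit into two arcs, of which the shorter has length at most
    [p / 2]; it may run through the end of the period. *)
Lemma close_return {d} p g (x : Sigma d) : (1 <= p)%nat -> shift_by p x = x ->
  ~ gap g x -> exists i l, (1 <= l)%nat /\ (2 * l <= p)%nat /\
    agree (g + 1) (shift_by i x) (shift_by l (shift_by i x)).
Proof.
  intros hp hx hg.
  assert (hij : exists i j, (i < j < p)%nat /\ agree (g + 1) (shift_by i x) (shift_by j x)).
  { apply NNPP; intro hno; apply hg; intros i j hag.
    rewrite (shift_by_mod p x hx i hp), (shift_by_mod p x hx j hp) in *.
    pose proof (Nat.mod_upper_bound i p ltac:(lia)).
    pose proof (Nat.mod_upper_bound j p ltac:(lia)).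
    destruct (Nat.lt_trichotomy (i mod p) (j mod p)) as [hlt|[heq|hlt]].
    - exfalso; apply hno; exists (i mod p)%nat, (j mod p)%nat; split; [lia|exact hag].
    - rewrite heq; reflexivity.
    - exfalso; apply hno; exists (j mod p)%nat, (i mod p)%nat.
      split; [lia|apply agree_sym; exact hag]. }
  destruct hij as [i [j [hij hag]]].
  destruct (Nat.le_gt_cases (2 * (j - i)) p) as [h|h].
  - exists i, (j - i)%nat; split; [lia|split; [exact h|]].
    rewrite shift_by_add; replace (i + (j - i))%nat with j by lia; exact hag.
  - exists j, (p - (j - i))%nat; split; [lia|split; [lia|]].
    rewrite shift_by_add; replace (j + (p - (j - i)))%nat with (p + i)%nat by lia.
    rewrite <- shift_by_add, hx; apply agree_sym; exact hag.
Qed.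

(* Cutting an orbit at a close return halves the period at the price of a bounded
   factor on the cost, so a cost that is small against a power of the period
   survives until the gap is large. *)
Lemma gap_orbit {d} th C Pc (A : Sigma d -> R) k x p c :
  0 < th < 1 -> holder th C A -> (forall y, A y <= 0) -> 0 < Pc ->
  (1 <= p <= 2 ^ k)%nat -> shift_by p x = x ->
  - bsum A p x <= c -> 0 < c -> c * Pc * (1 + C / (1 - th) * Pc) ^ k <= 1 ->
  exists y q c' g, (1 <= q)%nat /\ shift_by q y = y /\ - bsum A q y <= c' /\ 0 < c' /\
    c' * Pc <= th ^ g /\ gap g y.
Proof.
  intros hth hA hneg hPc.
  assert (hC : 0 <= C / (1 - th)).
  { destruct hA; apply Rmult_le_pos; [|left; apply Rinv_0_lt_compat]; lra. }
  assert (hK : 1 <= 1 + C / (1 - th) * Pc) by nra.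
  revert x p c; induction k as [|k IH]; intros x p c hp hx hcost hc hck.
  all: assert (hcP : 0 < c * Pc) by (apply Rmult_lt_0_compat; lra).
  all: assert (hc1 : c * Pc <= 1) by
    (match type of hck with _ * ?K ^ ?m <= _ => pose proof (pow_R1_Rle K m hK) end; nra).
  (* [g] is the finest scale that the cost permits. If the gap fails there, the distortion of the
     return is below [C / (1 - th) * (c * Pc)], a multiple of the cost. *)
  all: assert (hg : exists g, th ^ (g + 1) < c * Pc <= th ^ g).
  1, 3: destruct (geom_small th (c * Pc) hth hcP) as [n0 hn0];
    induction n0 as [|n0 IHn]; [simpl in hn0; lra|];
    destruct (Rlt_le_dec (th ^ n0) (c * Pc)); [auto|];
    exists n0; rewrite Nat.add_1_r; split; auto.
  all: destruct hg as [g [hg1 hg2]].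
  all: destruct (classic (gap g x)) as [hgap|hgap];
    [exists x, p, c, g; repeat split; auto; lia|].
  all: destruct (close_return p g x ltac:(lia) hx hgap) as [i [l [hl [hlp hag]]]].
  { simpl in hp; lia. }
  pose (x1 := shift_by i x); pose (y := periodize l x1); fold x1 in hag.
  assert (hx1 : shift_by p x1 = x1).
  { unfold x1; rewrite shift_by_add, Nat.add_comm, <- shift_by_add, hx; reflexivity. }
  apply (IH y l (c * (1 + C / (1 - th) * Pc))).
  - simpl in hp; lia.
  - apply periodize_period.
  - pose proof (periodize_agree_long l (g + 1) x1 hl hag) as hy; fold y in hy.
    pose proof (distortion th C A l (g + 1) _ _ hth hA hy) as hd.
    apply Rabs_le_bounds in hd.
    (* As [A <= 0], the piece that is kept costs no more than the whole orbit. *)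
    assert (h1 : bsum A p x1 <= bsum A l x1).
    { replace p with (l + (p - l))%nat by lia; rewrite bsum_add.
      pose proof (bsum_le_const A 0 (p - l) (shift_by l x1) ltac:(auto)); lra. }
    unfold x1 in h1 at 1; rewrite (bsum_rotate A p x hx) in h1.
    assert (C / (1 - th) * th ^ (g + 1) <= C / (1 - th) * (c * Pc))
      by (apply Rmult_le_compat_l; lra).
    lra.
  - apply Rmult_lt_0_compat; lra.
  - simpl in hck; lra.
Qed.

Lemma minimal_period {d} p (x : Sigma d) : (1 <= p)%nat -> shift_by p x = x ->
  exists q, (1 <= q <= p)%nat /\ shift_by q x = x /\
    forall r, (1 <= r < q)%nat -> shift_by r x <> x.
Proof.
  induction p as [p IH] using lt_wf_ind; intros hp hx.
  destruct (classic (exists r, (1 <= r < p)%nat /\ shift_by r x = x)) as [[r [hr hrx]]|hno].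
  - destruct (IH r ltac:(lia) ltac:(lia) hrx) as [q [hq hq']].
    exists q; split; [lia|exact hq'].
  - exists p; split; [lia|split; auto]; intros r hr hrx; apply hno; exists r; auto.
Qed.

Lemma good_orbit {d} th C Pc (A : Sigma d -> R) :
  0 < th < 1 -> holder th C A -> (forall y, A y <= 0) -> 0 < Pc ->
  (forall n e, 0 < e -> exists x, forall i, (i < n)%nat -> - e <= A (shift_by i x)) ->
  exists y q c g, (1 <= q)%nat /\ shift_by q y = y /\
    (forall r, (1 <= r < q)%nat -> shift_by r y <> y) /\
    - bsum A q y <= c /\ 0 < c /\ c * Pc <= th ^ g /\ gap g y.
Proof.
  intros hth hA hneg hPc hmax.
  assert (hC : 0 <= C / (1 - th)).
  { destruct hA; apply Rmult_le_pos; [|left; apply Rinv_0_lt_compat]; lra. }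
  destruct (cheap_orbit th C (1 + C / (1 - th) * Pc) (/ Pc) A hth hA)
    as [k [x [p [c [hp [hx [hcost [hc hck]]]]]]]]; auto.
  { nra. } { apply Rinv_0_lt_compat; exact hPc. }
  destruct (gap_orbit th C Pc A k x p c) as [y [q [c' [g [hq [hy [hc1 [hc2 [hc3 hg]]]]]]]]]; auto.
  { apply (Rmult_le_compat_r Pc) in hck; [|lra]; rewrite Rinv_l in hck; lra. }
  destruct (minimal_period q y hq hy) as [q' [hq' [hy' hmin]]].
  exists y, q', c', g; repeat split; auto; [lia|].
  replace q with (q' + (q - q'))%nat in hc1 by lia; rewrite bsum_add in hc1.
  pose proof (bsum_le_const A 0 (q - q') (shift_by q' y) ltac:(auto)); lra.
Qed.

(** * Locking on a periodic orbit *)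

Definition near {d} (x0 : Sigma d) (n : nat) (x : Sigma d) : Prop :=
  exists i, agree n x (shift_by i x0).

(** The power [alpha] of the distance to the orbit: [th ^ t], where [t] is the longest agreement of
    [x] with an orbit point. *)
Definition orbit_dist {d} (th : R) (x0 x : Sigma d) : R :=
  if excluded_middle_informative (forall n, near x0 n x) then 0
  else th ^ epsilon (inhabits 0%nat) (fun t => near x0 t x /\ ~ near x0 (S t) x).

Lemma near_le {d} (x0 x : Sigma d) m n : (m <= n)%nat -> near x0 n x -> near x0 m x.
Proof. intros h [i hi]; exists i; eapply agree_le; eauto. Qed.

Lemma near_agree {d} (x0 x y : Sigma d) n : agree n x y -> near x0 n y -> near x0 n x.
Proof. intros h [i hi]; exists i; eapply agree_trans; eauto. Qed.

Lemma near_last {d} (x0 x : Sigma d) n : ~ near x0 n x ->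
  exists t, (t < n)%nat /\ near x0 t x /\ ~ near x0 (S t) x.
Proof.
  induction n as [|n IH]; intro h.
  - exfalso; apply h; exists 0%nat; intros k hk; lia.
  - destruct (classic (near x0 n x)) as [hn|hn]; [exists n; auto|].
    destruct (IH hn) as [t [ht ht']]; exists t; split; [lia|exact ht'].
Qed.

Lemma orbit_dist_cases {d} th (x0 x : Sigma d) :
  ((forall n, near x0 n x) /\ orbit_dist th x0 x = 0) \/
  exists t, near x0 t x /\ ~ near x0 (S t) x /\ orbit_dist th x0 x = th ^ t.
Proof.
  unfold orbit_dist; destruct excluded_middle_informative as [h|h]; [left; auto|right].
  apply not_all_ex_not in h; destruct h as [n hn].
  set (Q := fun t => near x0 t x /\ ~ near x0 (S t) x).
  assert (hQ : Q (epsilon (inhabits 0%nat) Q)).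
  { apply epsilon_spec; destruct (near_last x0 x n hn) as [t [_ ht]]; exists t; exact ht. }
  exists (epsilon (inhabits 0%nat) Q); destruct hQ; auto.
Qed.

Lemma orbit_dist_nonneg {d} th (x0 x : Sigma d) : 0 < th < 1 -> 0 <= orbit_dist th x0 x.
Proof.
  intro hth; destruct (orbit_dist_cases th x0 x) as [[_ ->]|[t [_ [_ ->]]]]; [lra|].
  left; apply geom_pos; auto.
Qed.

Lemma orbit_dist_far {d} th (x0 x : Sigma d) n : 0 < th < 1 ->
  ~ near x0 (S n) x -> th ^ n <= orbit_dist th x0 x.
Proof.
  intros hth h; destruct (orbit_dist_cases th x0 x) as [[h1 _]|[t [h1 [_ ->]]]].
  - exfalso; auto.
  - apply geom_le; auto; apply Nat.nlt_ge; intro hlt; apply h; eapply near_le; [|exact h1]; lia.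
Qed.

Lemma orbit_dist_near {d} th (x0 x : Sigma d) n : 0 < th < 1 ->
  near x0 n x -> orbit_dist th x0 x <= th ^ n.
Proof.
  intros hth h; destruct (orbit_dist_cases th x0 x) as [[_ ->]|[t [_ [h1 ->]]]].
  - left; apply geom_pos; auto.
  - apply geom_le; auto; apply Nat.nlt_ge; intro hlt; apply h1; eapply near_le; [|exact h]; lia.
Qed.

(** An ultrametric effect: either both points agree with the orbit on [n] symbols and both values
    lie in [[0, th ^ n]], or they leave it at the same time and the values coincide. *)
Lemma orbit_dist_holder {d} th (x0 : Sigma d) : 0 < th < 1 -> holder th 1 (orbit_dist th x0).
Proof.
  intro hth; split; [lra|]; intros n x y hxy; rewrite Rmult_1_l.
  pose proof (geom_pos th n hth).
  destruct (classic (near x0 n x)) as [hx|hx].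
  - assert (hy : near x0 n y) by (eapply near_agree; [apply agree_sym|]; eauto).
    pose proof (orbit_dist_near th x0 x n hth hx); pose proof (orbit_dist_near th x0 y n hth hy).
    pose proof (orbit_dist_nonneg th x0 x hth); pose proof (orbit_dist_nonneg th x0 y hth).
    apply Rabs_le; lra.
  - destruct (near_last x0 x n hx) as [t [ht [h1 h2]]].
    assert (h3 : near x0 t y)
      by (eapply near_agree; [apply agree_sym, (agree_le t n); [lia|]|]; eauto).
    assert (h4 : ~ near x0 (S t) y)
      by (intro h5; apply h2; eapply near_agree; [apply (agree_le (S t) n); [lia|]|]; eauto).
    assert (orbit_dist th x0 x = th ^ t).
    { apply Rle_antisym; [apply orbit_dist_near|apply orbit_dist_far]; auto. }
    assert (orbit_dist th x0 y = th ^ t).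
    { apply Rle_antisym; [apply orbit_dist_near|apply orbit_dist_far]; auto. }
    apply Rabs_le; lra.
Qed.

Lemma orbit_dist_orbit {d} th (x0 : Sigma d) i : orbit_dist th x0 (shift_by i x0) = 0.
Proof.
  destruct (orbit_dist_cases th x0 (shift_by i x0)) as [[_ h]|[t [_ [h _]]]]; [exact h|].
  exfalso; apply h; exists i; intros k _; reflexivity.
Qed.

Lemma near_all {d} p (x0 x : Sigma d) : (1 <= p)%nat -> shift_by p x0 = x0 ->
  (forall n, near x0 n x) -> exists i, (i < p)%nat /\ x = shift_by i x0.
Proof.
  intros hp hx0 h.
  assert (hth : 0 < / 2 < 1) by lra.
  (* The orbit point may vary with the depth. Here [e] encodes the depth through [e <= (/ 2) ^ n],
     so that the pigeonhole over small reals fixes one index. *)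
  destruct (pigeonhole_small
    (fun i e => forall n, e <= (/ 2) ^ n -> agree n x (shift_by i x0)) p) as [i [hi hi']].
  - intros c e e' he hee n hn; apply he; lra.
  - intros e he; destruct (geom_small _ e hth he) as [n0 hn0].
    destruct (h n0) as [i hi]; exists (i mod p)%nat; split.
    + apply Nat.mod_upper_bound; lia.
    + intros n hn; rewrite <- shift_by_mod by auto.
      apply (agree_le n n0); [|exact hi].
      apply Nat.nlt_ge; intro hlt.
      pose proof (geom_le (/ 2) n0 n hth ltac:(lia)); lra.
  - exists i; split; [exact hi|apply agree_all_eq; intro n].
    apply (hi' ((/ 2) ^ n)); [apply geom_pos; exact hth|lra].
Qed.

(** Full periods cancel, and fewer than [p] terms remain. *)
Lemma bsum_orbit_le {d} a p (K : Sigma d -> R) x : (1 <= p)%nat -> shift_by p x = x ->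
  0 <= a -> (forall y, K y <= a) -> bsum K p x = 0 ->
  forall n, bsum K n x <= INR p * a.
Proof.
  intros hp hx ha hK h0 n.
  rewrite (Nat.div_mod_eq n p), (Nat.mul_comm p), bsum_add, bsum_periodic, h0 by exact hx.
  rewrite shift_by_mul by exact hx.
  assert (bsum K (n mod p) x <= INR (n mod p) * a) by (apply bsum_le_const; auto).
  assert (INR (n mod p) * a <= INR p * a).
  { apply Rmult_le_compat_r; [exact ha|apply le_INR].
    pose proof (Nat.mod_upper_bound n p ltac:(lia)); lia. }
  lra.
Qed.

(* A point that is close to the orbit follows it until it has moved away to the
   scale of the gap. Along this stretch the sum of [K] is nearly an orbit sum,
   hence at most about [p * a]; the last step pays [eps * th ^ (g + 1)], which
   outweighs it. At all points that are not close the summand is nonpositive. *)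
Lemma shadowing_bound {d} th C a eps p g s (K : Sigma d -> R) (x0 : Sigma d) :
  0 < th < 1 -> holder th C K -> (1 <= p)%nat -> shift_by p x0 = x0 -> gap g x0 ->
  (forall x, K x <= a) -> 0 <= a -> bsum K p x0 = 0 -> (1 <= s)%nat ->
  0 < eps -> a <= eps * th ^ (g + s) ->
  INR p * a + C / (1 - th) * th ^ (g + s) + a <= eps * th ^ (g + 1) ->
  forall n x, bsum (fun y => K y + - eps * orbit_dist th x0 y) n x <= INR p * a + C / (1 - th).
Proof.
  intros hth hK hp hx0 hgap hKa ha h0 hs heps hfar hpay.
  set (H := fun y => K y + - eps * orbit_dist th x0 y).
  assert (hC : 0 <= C / (1 - th)).
  { destruct hK; apply Rmult_le_pos; [|left; apply Rinv_0_lt_compat]; lra. }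
  assert (hpa : 0 <= INR p * a) by (apply Rmult_le_pos; [apply pos_INR|lra]).
  assert (hHK : forall y, H y <= K y).
  { intro y; unfold H; pose proof (orbit_dist_nonneg th x0 y hth); nra. }
  assert (hHfar : forall y n, ~ near x0 (S n) y -> H y <= a - eps * th ^ n).
  { intros y n hn; unfold H; pose proof (orbit_dist_far th x0 y n hth hn).
    specialize (hKa y); nra. }
  (* The penalty at this depth is at least [eps * th ^ (g + s) >= a]. *)
  assert (hHneg : forall y, ~ near x0 (g + s + 1) y -> H y <= 0).
  { intros y hy; rewrite Nat.add_1_r in hy; specialize (hHfar y _ hy); lra. }
  assert (hshadow : forall l t i x, (l + t)%nat = i \/ (l + t <= i)%nat ->
    near x0 i x -> bsum H l x <= INR p * a + C / (1 - th) * th ^ t).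
  { intros l t i x hlt [j hj].
    assert (hag : agree (l + t) x (shift_by j x0)) by (apply (agree_le _ i); [lia|exact hj]).
    pose proof (distortion th C K l t _ _ hth hK hag) as hd; apply Rabs_le_bounds in hd.
    assert (bsum H l x <= bsum K l x) by (apply bsum_le; auto).
    assert (bsum K l (shift_by j x0) <= INR p * a).
    { apply bsum_orbit_le; auto; [|rewrite bsum_rotate; auto].
      rewrite shift_by_add, Nat.add_comm, <- shift_by_add, hx0; reflexivity. }
    lra. }
  assert (hth1 : forall t, th ^ t <= 1) by (intro t; apply (geom_le th 0 t hth); lia).
  intro n; induction n as [n IH] using lt_wf_ind; intro x.
  destruct (classic (near x0 (n + (g + 1)) x)) as [hnear|hnear].
  { eapply Rle_trans; [apply (hshadow n (g + 1)%nat (n + (g + 1))%nat); auto|].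
    specialize (hth1 (g + 1)%nat); nra. }
  destruct (near_last _ _ _ hnear) as [t [ht [hn1 hn2]]].
  destruct n as [|n]; [simpl; lra|].
  destruct (Nat.lt_ge_cases t (g + s + 1)) as [hts|hts].
  { simpl bsum.
    assert (H x <= 0) by (apply hHneg; intro hc; apply hn2; eapply near_le; [|exact hc]; lia).
    specialize (IH n ltac:(lia) (shift x)); lra. }
  (* While more than [g] symbols of agreement remain, the gap leaves only one candidate to follow. A
     longer agreement of [shift_by i x] with the orbit would thus extend the agreement of [x] itself
     beyond [t]. *)
  assert (hfollow : forall i, (i + g + 1 <= t)%nat -> ~ near x0 (S (t - i)) (shift_by i x)).
  { intros i hi [j hj]; destruct hn1 as [l hl]; apply hn2; exists l.
    assert (h1 : agree (t - i) (shift_by i x) (shift_by i (shift_by l x0))).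
    { apply agree_shift_by; replace (i + (t - i))%nat with t by lia; exact hl. }
    assert (h2 : shift_by j x0 = shift_by i (shift_by l x0)).
    { rewrite shift_by_add; apply hgap; rewrite <- (shift_by_add i l).
      eapply agree_trans; [apply agree_sym, (agree_le _ (S (t - i))); [|exact hj]; lia|].
      apply (agree_le _ (t - i)); [lia|exact h1]. }
    rewrite h2 in hj.
    replace (S t) with (i + S (t - i))%nat by lia; apply agree_add; [|exact hj].
    apply (agree_le _ t); [lia|exact hl]. }
  (* The stretch has three parts: [t - g - s] steps of shadowing with [g + s] symbols in reserve,
     [s - 1] nonpositive steps, and the last step, which pays [eps * th ^ (g + 1)]. *)
  assert (hexc : bsum H (t - g) x <= 0).
  { replace (t - g)%nat with ((t - g - s) + ((s - 1) + 1))%nat by lia; rewrite !bsum_add.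
    pose proof (hshadow (t - g - s)%nat (g + s)%nat t x ltac:(lia) hn1).
    assert (bsum H (s - 1) (shift_by (t - g - s) x) <= INR (s - 1) * 0).
    { apply bsum_le_const; intros i hi; rewrite shift_by_add; apply hHneg.
      intro hc; apply (hfollow (t - g - s + i)%nat); [lia|]; eapply near_le; [|exact hc]; lia. }
    rewrite shift_by_add.
    replace (t - g - s + (s - 1))%nat with (t - g - 1)%nat by lia.
    assert (H (shift_by (t - g - 1) x) <= a - eps * th ^ (g + 1)).
    { apply hHfar; pose proof (hfollow (t - g - 1)%nat ltac:(lia)) as hf.
      replace (t - (t - g - 1))%nat with (g + 1)%nat in hf by lia; exact hf. }
    simpl bsum at 3; lra. }
  replace (S n) with ((t - g) + (S n - (t - g)))%nat by lia; rewrite bsum_add.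
  specialize (IH (S n - (t - g))%nat ltac:(lia) (shift_by (t - g) x)); lra.
Qed.

(** The orbit and [r] depend on [F] and [eps] only and serve all small [h] at once; this uniformity
    is what produces a ball. *)
Lemma locking {d} th C M eps (F : Sigma d -> R) (z0 : Sigma d) :
  0 < th < 1 -> holder th C F -> (forall x, Rabs (F x) <= M) -> 0 < eps ->
  exists x0 p r, (1 <= p)%nat /\ shift_by p x0 = x0 /\
    (forall i, (1 <= i < p)%nat -> shift_by i x0 <> x0) /\ 0 < r /\
    forall h r1 r2, holder th r2 h -> r2 <= r -> (forall x, Rabs (h x) <= r1) -> r1 <= r ->
    exists v C', holder th C' v /\ forall x,
      F x - eps * orbit_dist th x0 x + h x
        - bsum (fun y => F y + h y) p x0 / INR p + v x - v (shift x) <= 0.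
Proof.
  intros hth hF hM heps.
  destruct (near_maximal_orbits th C M F z0 hth hF hM) as [m [u [Cu [hu [hneg hmax]]]]].
  set (A := fun x => (F x + - m) + (u x + -1 * u (shift x))).
  pose (CA := (C + 0) + (Cu + Rabs (-1) * (Cu / th))).
  assert (hA : holder th CA A).
  { apply holder_plus; apply holder_plus; auto; [apply holder_const|].
    apply (holder_scal th _ (-1) (fun x => u (shift x))), holder_shift; auto. }
  assert (hAneg : forall y, A y <= 0) by (intro y; specialize (hneg y); unfold A; lra).
  assert (hAmax : forall n e, 0 < e ->
    exists x, forall i, (i < n)%nat -> - e <= A (shift_by i x)).
  { intros n e he; destruct (hmax n e he) as [x hx]; exists x; intros i hi.
    specialize (hx i hi); unfold A; lra. }
  pose (CK := (CA + 1 + 0) / (1 - th)).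
  assert (hCK : 0 <= CK).
  { destruct hA; apply Rmult_le_pos; [|left; apply Rinv_0_lt_compat]; lra. }
  assert (het : 0 < eps * th) by (apply Rmult_lt_0_compat; lra).
  (* [s] is chosen so that the distortion uses up at most half of the payment
     [eps * th ^ (g + 1)]. *)
  destruct (geom_small th (eps * th / (2 * (CK + 1))) hth) as [s0 hs0].
  { apply Rmult_lt_0_compat; [lra|apply Rinv_0_lt_compat; lra]. }
  set (s := S s0).
  assert (hs : CK * th ^ s <= eps * th / 2).
  { assert (th ^ s < eps * th / (2 * (CK + 1))).
    { eapply Rle_lt_trans; [apply (geom_le th s0 s hth); unfold s; lia|exact hs0]. }
    apply (Rmult_lt_compat_l (CK + 1)) in H; [|lra].
    replace ((CK + 1) * (eps * th / (2 * (CK + 1)))) with (eps * th / 2) in H by (field; lra).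
    pose proof (geom_pos th s hth); nra. }
  (* The first summand yields [8 * c <= eps * th ^ (g + 1)], so [INR p * a + a <= 4 * c] fits in the
     other half of the payment. The second yields [a <= 2 * c <= eps * th ^ (g + s)]. *)
  pose (Pc := 8 / (eps * th) + 2 / (eps * th ^ s)).
  assert (hes : 0 < eps * th ^ s) by (apply Rmult_lt_0_compat; [|apply geom_pos]; auto).
  assert (hP1 : 0 < 8 / (eps * th)) by (apply Rmult_lt_0_compat; [lra|apply Rinv_0_lt_compat; lra]).
  assert (hP2 : 0 < 2 / (eps * th ^ s)) by (apply Rmult_lt_0_compat; [lra|apply Rinv_0_lt_compat; lra]).
  destruct (good_orbit th CA Pc A hth hA hAneg) as [x0 [p [c [g [hp [hx0 [hmin [hc1 [hc2 [hc3 hgap]]]]]]]]]].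
  { unfold Pc; lra. } { exact hAmax. }
  assert (hp0 : 1 <= INR p) by (apply (le_INR 1); exact hp).
  (* The bound [1] keeps the Hölder constant of [K] independent of [h]. The bound [c / (2 * INR p)]
     lets [h] raise [K] by at most [c / INR p], so that [a] is twice the average cost bound. *)
  exists x0, p, (Rmin 1 (c / (2 * INR p))).
  split; [exact hp|split; [exact hx0|split; [exact hmin|split]]].
  { apply Rmin_glb_lt; [lra|apply Rmult_lt_0_compat; [lra|apply Rinv_0_lt_compat; lra]]. }
  intros h r1 r2 hh hr2 hh1 hr1.
  assert (hr2' : r2 <= 1) by (eapply Rle_trans; [exact hr2|apply Rmin_l]).
  assert (hr1' : r1 <= c / (2 * INR p)) by (eapply Rle_trans; [exact hr1|apply Rmin_r]).
  pose (avg := bsum (fun y => A y + h y) p x0 / INR p).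
  set (K := fun x => (A x + h x) + - avg).
  assert (hh' : holder th 1 h).
  { destruct hh as [q1 q2]; split; [lra|]; intros n x y hxy.
    eapply Rle_trans; [apply (q2 _ _ _ hxy)|]; apply Rmult_le_compat_r; [|lra].
    left; apply geom_pos; auto. }
  assert (hK : holder th (CA + 1 + 0) K)
    by (apply holder_plus; [apply holder_plus; auto|apply holder_const]).
  assert (hsumK : bsum K p x0 = 0).
  { unfold K; rewrite bsum_plus, bsum_const; unfold avg; field; lra. }
  pose (a := 2 * c / INR p).
  assert (havg : - (c / INR p) - r1 <= avg).
  { unfold avg; rewrite bsum_plus.
    assert (INR p * - r1 <= bsum h p x0).
    { apply bsum_ge_const; intros i _; pose proof (hh1 (shift_by i x0)) as q.
      apply Rabs_le_bounds in q; lra. }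
    apply (Rmult_le_reg_r (INR p)); [lra|].
    replace ((- (c / INR p) - r1) * INR p) with (- c - r1 * INR p) by (field; lra).
    replace ((bsum A p x0 + bsum h p x0) / INR p * INR p) with (bsum A p x0 + bsum h p x0)
      by (field; lra). lra. }
  assert (hKa : forall x, K x <= a).
  { intro x; unfold K; specialize (hAneg x); pose proof (hh1 x) as q; apply Rabs_le_bounds in q.
    assert (a = c / INR p + 2 * (c / (2 * INR p))) by (unfold a; field; lra). lra. }
  assert (hpa : INR p * a = 2 * c) by (unfold a; field; lra).
  assert (ha0 : 0 < a) by (apply Rmult_lt_0_compat; [lra|apply Rinv_0_lt_compat; lra]).
  assert (ha1 : a <= 2 * c) by (rewrite <- hpa; nra).
  pose proof (geom_pos th g hth) as hg0.
  assert (hc4 : 8 * c <= eps * th * th ^ g).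
  { assert (hq : c * (8 / (eps * th)) <= th ^ g) by (unfold Pc in hc3; nra).
    apply (Rmult_le_compat_l (eps * th)) in hq; [|lra].
    replace (eps * th * (c * (8 / (eps * th)))) with (8 * c) in hq by (field; lra). exact hq. }
  assert (hc5 : 2 * c <= eps * th ^ s * th ^ g).
  { assert (hq : c * (2 / (eps * th ^ s)) <= th ^ g) by (unfold Pc in hc3; nra).
    apply (Rmult_le_compat_l (eps * th ^ s)) in hq; [|lra].
    replace (eps * th ^ s * (c * (2 / (eps * th ^ s)))) with (2 * c) in hq
      by (field; split; [apply pow_nonzero|]; lra). exact hq. }
  assert (hbound := shadowing_bound th (CA + 1 + 0) a eps p g s K x0 hth hK hp hx0 hgap hKa
    ltac:(lra) hsumK ltac:(unfold s; lia) heps).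
  rewrite hpa in hbound; fold CK in hbound.
  assert (hcmp : bsum (fun y => F y + h y) p x0 / INR p = m + avg).
  { unfold avg, A; rewrite !bsum_plus, bsum_const.
    rewrite <- (bsum_plus u (fun x => -1 * u (shift x))).
    rewrite (bsum_ext (fun x => u x + -1 * u (shift x)) (fun x => u x - u (shift x)))
      by (intro; ring).
    rewrite bsum_coboundary, hx0; field; lra. }
  destruct (subaction th (CA + 1 + 0 + Rabs (- eps) * 1) (2 * c + CK)
    (fun y => K y + - eps * orbit_dist th x0 y) hth) as [v [hv hsub]].
  { apply holder_plus; [exact hK|]; apply holder_scal, orbit_dist_holder; exact hth. }
  { apply hbound.
    - rewrite pow_add; nra.
    - rewrite !pow_add, pow_1.
      assert (CK * (th ^ g * th ^ s) <= eps * th / 2 * th ^ g)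
        by (replace (CK * (th ^ g * th ^ s)) with (CK * th ^ s * th ^ g) by ring;
            apply Rmult_le_compat_r; lra).
      nra. }
  eexists (fun x => v x + u x), _; split; [apply holder_plus; [exact hv|exact hu]|].
  intro x; specialize (hsub x); rewrite hcmp; unfold K, A in hsub; lra.
Qed.

(** * Integration over cylinders *)

Lemma first_diff_spec {d} (x y : Sigma d) : ~ same x y ->
  x (first_diff x y) <> y (first_diff x y) /\ agree (first_diff x y) x y.
Proof.
  intro h; unfold first_diff; apply epsilon_spec.
  apply not_all_ex_not in h; destruct h as [n hn].
  induction n as [n IH] using lt_wf_ind.
  destruct (classic (exists k, (k < n)%nat /\ x k <> y k)) as [[k [hk hk']]|hno].
  - exact (IH k hk hk').
  - exists n; split; [exact hn|]; intros k hk; apply NNPP; intro; apply hno; exists k; auto.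
Qed.

Lemma agree_dist {d} lam n (x y : Sigma d) : 0 < lam < 1 ->
  agree n x y -> dist lam x y <= lam ^ n.
Proof.
  intros hl h; unfold dist; destruct excluded_middle_informative as [hs|hs].
  - left; apply geom_pos; exact hl.
  - apply geom_le; [exact hl|]; apply Nat.nlt_ge; intro hlt.
    apply (proj1 (first_diff_spec x y hs)), h, hlt.
Qed.

Lemma dist_agree {d} lam n (x y : Sigma d) : 0 < lam < 1 ->
  dist lam x y < lam ^ n -> agree n x y.
Proof.
  intros hl h; unfold dist in h; destruct excluded_middle_informative as [hs|hs].
  - intros k _; apply hs.
  - destruct (first_diff_spec x y hs) as [_ ha]; apply (agree_le _ (first_diff x y)); [|exact ha].
    apply Nat.nlt_ge; intro hlt.
    pose proof (geom_le lam (first_diff x y) n hl ltac:(lia)); lra.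
Qed.

Lemma is_open_agree {d} lam (V : Sigma d -> Prop) : 0 < lam < 1 ->
  (is_open lam V <-> forall x, V x -> exists n, forall y, agree n x y -> V y).
Proof.
  intro hl; split; intros h x hx.
  - destruct (h x hx) as [e [he hV]]; destruct (geom_small lam e hl he) as [n hn].
    exists n; intros y hy; apply hV; pose proof (agree_dist lam n x y hl hy); lra.
  - destruct (h x hx) as [n hn]; exists (lam ^ n); split; [apply geom_pos; exact hl|].
    intros y hy; apply hn, (dist_agree lam); auto.
Qed.

Lemma borel_cylinder {d} lam n (V : Sigma d -> Prop) : 0 < lam < 1 ->
  (forall x y, agree n x y -> V x -> V y) -> borel lam V.
Proof.
  intros hl h; apply borel_open, is_open_agree; auto; intros x hx; exists n; eauto.
Qed.

Lemma borel_and {d} lam (A B : Sigma d -> Prop) :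
  borel lam A -> borel lam B -> borel lam (fun x => A x /\ B x).
Proof.
  intros hA hB.
  apply borel_ext with (fun x => ~ exists n : nat, (match n with O => fun y => ~ A y | _ => fun y => ~ B y end) x).
  - apply borel_compl, borel_union; intros [|n]; apply borel_compl; assumption.
  - intro x; split.
    + intro h; split; apply NNPP; intro h'; apply h; [exists 0%nat|exists 1%nat]; exact h'.
    + intros [h1 h2] [[|n] h]; auto.
Qed.

Lemma borel_level {d} lam th C (F : Sigma d -> R) s t : 0 < lam < 1 -> 0 < th < 1 ->
  holder th C F -> borel lam (fun x => s <= F x < t).
Proof.
  intros hl hth [hC hF].
  assert (hlt : forall c, borel lam (fun x => F x < c)).
  { intro c; apply borel_open, is_open_agree; auto; intros x hx.
    destruct (geom_small th ((c - F x) / (C + 1)) hth) as [n hn].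
    { apply Rmult_lt_0_compat; [lra|apply Rinv_0_lt_compat; lra]. }
    exists n; intros y hy; specialize (hF n y x (agree_sym _ _ _ hy)).
    apply Rabs_le_bounds in hF; apply (Rmult_lt_compat_l (C + 1)) in hn; [|lra].
    replace ((C + 1) * ((c - F x) / (C + 1))) with (c - F x) in hn by (field; lra).
    pose proof (geom_pos th n hth); nra. }
  apply borel_and; [|apply hlt].
  apply borel_ext with (fun x => ~ F x < s); [apply borel_compl, hlt|intro x; split; lra].
Qed.

(** The loss of one symbol is allowed so that both the identity and [shift] are covered. *)
Lemma borel_fiber {d} lam (f : Sigma d -> Sigma d) y : 0 < lam < 1 ->
  (forall n x z, agree (S n) x z -> agree n (f x) (f z)) -> borel lam (fun x => f x = y).
Proof.
  intros hl hf; apply borel_ext with (fun x => ~ f x <> y).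
  - apply borel_compl, borel_open, is_open_agree; auto; intros x hx.
    destruct (classic (exists n, ~ agree n (f x) y)) as [[n hn]|hno].
    + exists (S n); intros z hz hzy; apply hn; rewrite <- hzy; apply hf, hz.
    + exfalso; apply hx, agree_all_eq; intro n; apply NNPP; intro; apply hno; exists n; auto.
  - intro x; split; [apply NNPP|auto].
Qed.

Lemma borel_point {d} lam (y : Sigma d) : 0 < lam < 1 -> borel lam (fun x => x = y).
Proof.
  intro hl; apply (borel_fiber lam (fun x => x)); auto.
  intros n x z h; apply (agree_le n (S n)); [lia|exact h].
Qed.

(** * Finite Borel partitions and their sums *)

Lemma infinite_sum_unique f l l' : infinite_sum f l -> infinite_sum f l' -> l = l'.
Proof. exact (UL_sequence (sum_f_R0 f) l l'). Qed.

Lemma infinite_sum_finite f K :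
  (forall n, (K < n)%nat -> f n = 0) -> infinite_sum f (sum_f_R0 f K).
Proof.
  intros h e he; exists K; intros n hn.
  assert (hs : sum_f_R0 f n = sum_f_R0 f K).
  { induction n as [|n IH]; [replace K with 0%nat by lia; reflexivity|].
    destruct (Nat.eq_dec K (S n)) as [->|hK]; [reflexivity|].
    simpl; rewrite IH, h by lia; ring. }
  rewrite hs; unfold Rdist; rewrite Rminus_diag, Rabs_R0; exact he.
Qed.

(** Apply countable additivity to infinitely many empty sets: multiples of a nonzero constant cannot
    converge to it. Finite additivity rests on this. *)
Lemma measure_empty {d} lam mu (V : Sigma d -> Prop) : prob_measure lam mu ->
  (forall x, ~ V x) -> mu V = 0.
Proof.
  intros [hext [_ [_ hadd]]] hV.
  rewrite (hext V (fun _ => False)) by (intro x; split; [apply hV|tauto]).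
  pose proof (hadd (fun _ _ => False)) as h; simpl in h.
  rewrite (hext (fun x => exists n : nat, False) (fun _ => False)) in h
    by (intro x; split; [intros [_ []]|tauto]).
  set (c := mu (fun _ => False)) in *; apply NNPP; intro hc.
  destruct h with (eps := Rabs c) as [N hN].
  { intro n; apply borel_open; intros x []. }
  { tauto. }
  { apply Rabs_pos_lt; exact hc. }
  specialize (hN (S N) ltac:(lia)); rewrite sum_cte in hN; unfold Rdist in hN.
  replace (c * INR (S (S N)) - c) with (c * INR (S N)) in hN
    by (rewrite (S_INR (S N)); ring).
  rewrite Rabs_mult, (Rabs_right (INR (S N))) in hN by (apply Rle_ge, pos_INR).
  pose proof (Rabs_pos c); pose proof (pos_INR N); rewrite S_INR in hN; nra.
Qed.

(** A finite Borel partition given by numbering its cells. [expect] then integrates the simple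
    function [f (a x)]. *)
Definition label {d} (lam : R) (K : nat) (a : Sigma d -> nat) : Prop :=
  (forall x, (a x <= K)%nat) /\ forall j, borel lam (fun x => a x = j).

Definition expect {d} (mu : (Sigma d -> Prop) -> R) K (a : Sigma d -> nat) (f : nat -> R) : R :=
  sum_f_R0 (fun j => f j * mu (fun x => a x = j)) K.

Lemma measure_partition {d} lam mu K (a : Sigma d -> nat) B : prob_measure lam mu ->
  label lam K a -> borel lam B -> mu B = sum_f_R0 (fun j => mu (fun x => B x /\ a x = j)) K.
Proof.
  intros hmu [hK hb] hB; pose proof hmu as [hext [_ [_ hadd]]].
  apply infinite_sum_unique with (fun j => mu (fun x => B x /\ a x = j)).
  - rewrite (hext B (fun x => exists j, B x /\ a x = j)).
    + apply hadd; [intro n; apply borel_and; auto|].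
      intros n m x hnm [_ h1] [_ h2]; congruence.
    + intro x; split; [intro h; exists (a x); auto|intros [j [h _]]; exact h].
  - apply infinite_sum_finite; intros n hn; apply (measure_empty lam); auto.
    intros x [_ h]; specialize (hK x); lia.
Qed.

Lemma sum_swap (f : nat -> nat -> R) K L :
  sum_f_R0 (fun j => sum_f_R0 (f j) L) K = sum_f_R0 (fun l => sum_f_R0 (fun j => f j l) K) L.
Proof.
  induction K as [|K IH]; simpl; [reflexivity|].
  rewrite IH, <- sum_plus; reflexivity.
Qed.

(** Both sums are refined to the common partition. On an empty cell the pointwise inequality says
    nothing, but the measure vanishes. *)
Lemma expect_le {d} lam mu K K' (a a' : Sigma d -> nat) f f' e : prob_measure lam mu ->
  label lam K a -> label lam K' a' -> (forall x, f (a x) <= f' (a' x) + e) ->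
  expect mu K a f <= expect mu K' a' f' + e.
Proof.
  intros hmu ha ha' h; pose proof hmu as [hext [hpos [h1 _]]].
  pose (c := fun j l => mu (fun x => a x = j /\ a' x = l)).
  assert (e1 : expect mu K a f = sum_f_R0 (fun j => sum_f_R0 (fun l => f j * c j l) K') K).
  { apply sum_eq; intros j _; unfold c.
    rewrite (measure_partition lam mu K' a' _ hmu ha' (proj2 ha j)), scal_sum.
    apply sum_eq; intros; ring. }
  assert (e2 : expect mu K' a' f' = sum_f_R0 (fun j => sum_f_R0 (fun l => f' l * c j l) K') K).
  { rewrite sum_swap; apply sum_eq; intros l _; unfold c.
    rewrite (measure_partition lam mu K a _ hmu ha (proj2 ha' l)), scal_sum.
    apply sum_eq; intros j _; rewrite Rmult_comm; f_equal; apply hext; tauto. }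
  assert (e3 : e = sum_f_R0 (fun j => sum_f_R0 (fun l => e * c j l) K') K).
  { rewrite <- (Rmult_1_r e) at 1; rewrite <- h1.
    rewrite (measure_partition lam mu K a (fun _ => True) hmu ha)
      by (apply (borel_open lam); intros x _; exists 1; split; [lra|auto]).
    rewrite scal_sum; apply sum_eq; intros j _.
    rewrite (hext _ (fun x => a x = j)) by tauto.
    rewrite (measure_partition lam mu K' a' _ hmu ha' (proj2 ha j)), Rmult_comm, scal_sum.
    apply sum_eq; intros; unfold c; ring. }
  rewrite e1, e2; rewrite e3 at 1; rewrite <- sum_plus.
  apply sum_Rle; intros j _; rewrite <- sum_plus; apply sum_Rle; intros l _.
  rewrite <- Rmult_plus_distr_r.
  destruct (classic (exists x, a x = j /\ a' x = l)) as [[x [<- <-]]|hno].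
  - apply Rmult_le_compat_r; [|apply h].
    apply hpos, borel_and; [apply ha|apply ha'].
  - unfold c; rewrite (measure_empty lam) by (auto; intros x hx; apply hno; exists x; exact hx).
    lra.
Qed.

Lemma expect_plus {d} mu K (a : Sigma d -> nat) f g :
  expect mu K a (fun j => f j + g j) = expect mu K a f + expect mu K a g.
Proof.
  unfold expect; rewrite <- sum_plus; apply sum_eq; intros; ring.
Qed.

Lemma expect_scal {d} mu K (a : Sigma d -> nat) c f :
  expect mu K a (fun j => c * f j) = c * expect mu K a f.
Proof. unfold expect; rewrite scal_sum; apply sum_eq; intros; ring. Qed.

Lemma nat_floor y : 0 <= y -> exists j, INR j <= y < INR j + 1.
Proof.
  intro hy; destruct (INR_unbounded y) as [n hn].
  induction n as [|n IH]; [simpl in hn; lra|].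
  rewrite S_INR in hn; destruct (Rlt_le_dec y (INR n)); [auto|exists n; lra].
Qed.

(** For [n >= M] the truncation is inactive and the dyadic levels partition the space; the top index
    catches [F x = INR n]. *)
Lemma integral_approx_label {d} lam th C M (F : Sigma d -> R) n :
  0 < lam < 1 -> 0 < th < 1 -> holder th C F -> (forall x, Rabs (F x) <= M) -> M <= INR n ->
  exists K a f, label lam K a /\ (forall mu, prob_measure lam mu ->
      integral_approx mu F n = expect mu K a f) /\
    forall x, f (a x) <= F x <= f (a x) + / 2 ^ n.
Proof.
  intros hl hth hF hM hn.
  pose (f := fun j => (INR j - INR n * 2 ^ n) / 2 ^ n).
  pose (Q := fun x j => f j <= F x < f j + / 2 ^ n).
  assert (h2 : 0 < 2 ^ n) by (apply pow_lt; lra).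
  assert (hQ : forall x j, Q x j <-> INR j <= (F x + INR n) * 2 ^ n < INR j + 1).
  { intros x j; unfold Q, f.
    replace ((INR j - INR n * 2 ^ n) / 2 ^ n) with (INR j * / 2 ^ n - INR n) by (field; lra).
    assert (hi : 0 < / 2 ^ n) by (apply Rinv_0_lt_compat; exact h2).
    assert (hF1 : F x + INR n = (F x + INR n) * 2 ^ n * / 2 ^ n) by (field; lra).
    split; intros [q1 q2]; split.
    - apply (Rmult_le_reg_r (/ 2 ^ n)); lra.
    - apply (Rmult_lt_reg_r (/ 2 ^ n)); lra.
    - apply (Rmult_le_compat_r (/ 2 ^ n)) in q1; lra.
    - apply (Rmult_lt_compat_r (/ 2 ^ n)) in q2; lra. }
  assert (hex : forall x, exists j, Q x j).
  { intro x; destruct (nat_floor ((F x + INR n) * 2 ^ n)) as [j hj].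
    - specialize (hM x); apply Rabs_le_bounds in hM; apply Rmult_le_pos; lra.
    - exists j; apply hQ; exact hj. }
  pose (a := fun x => epsilon (inhabits 0%nat) (Q x)).
  assert (ha : forall x, Q x (a x)) by (intro x; apply epsilon_spec, hex).
  assert (huniq : forall x j, Q x j <-> a x = j).
  { intros x j; split; [|intros <-; apply ha]; intro hj.
    pose proof (proj1 (hQ _ _) (ha x)); apply hQ in hj.
    assert (a x < S j)%nat by (apply INR_lt; rewrite S_INR; lra).
    assert (j < S (a x))%nat by (apply INR_lt; rewrite S_INR; lra). lia. }
  exists (2 * n * 2 ^ n)%nat, a, f; split; [split|split].
  - intro x; apply INR_le; rewrite !mult_INR, pow_INR.
    pose proof (proj1 (hQ _ _) (ha x)); specialize (hM x); apply Rabs_le_bounds in hM.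
    change (INR 2) with 2 in *; nra.
  - intro j; apply borel_ext with (fun x => f j <= F x < f j + / 2 ^ n);
      [|intro x; apply huniq]. eapply borel_level; eauto.
  - intros mu hmu; unfold integral_approx, expect; apply sum_eq; intros j _; cbv zeta.
    f_equal; apply (proj1 hmu); intro x; apply huniq.
  - intro x; destruct (ha x); lra.
Qed.

(** A representative of each cylinder of length [k]. A number that codes no word gets an arbitrary
    point, and its cell is empty. *)
Definition decode {d} (x0 : Sigma d) k c : Sigma d :=
  epsilon (inhabits x0) (fun y => code k y = c).

Lemma decode_agree {d} (x0 : Sigma d) k x : agree k (decode x0 k (code k x)) x.
Proof.
  apply code_inj; unfold decode.
  apply (epsilon_spec (inhabits x0) (fun y => code k y = code k x)); exists x; reflexivity.
Qed.

Lemma label_code {d} lam k : 0 < lam < 1 -> label lam (d ^ k) (code (d := d) k).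
Proof.
  intro hl; split; [intro x; pose proof (code_lt k x); lia|].
  intro j; apply (borel_cylinder lam k); auto.
  intros x y hxy <-; symmetry; apply code_agree; exact hxy.
Qed.

Lemma label_code_shift {d} lam k : 0 < lam < 1 ->
  label lam (d ^ k) (fun x : Sigma d => code k (shift x)).
Proof.
  intro hl; split; [intro x; pose proof (code_lt k (shift x)); lia|].
  intro j; apply (borel_cylinder lam (S k)); auto.
  intros x y hxy <-; symmetry; apply code_agree; apply (agree_shift_by 1 k); exact hxy.
Qed.

Lemma Un_cv_le_const u l c N : Un_cv u l -> (forall n, (N <= n)%nat -> u n <= c) -> l <= c.
Proof.
  intros h hc; apply Rnot_lt_le; intro hlt.
  destruct (h (l - c)) as [N' hN']; [lra|].
  specialize (hN' (max N N') ltac:(lia)); specialize (hc (max N N') ltac:(lia)).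
  unfold Rdist in hN'; apply Rabs_def2 in hN'; lra.
Qed.

Lemma half_pow_small e : 0 < e -> exists N, forall n, (N <= n)%nat -> / 2 ^ n < e.
Proof.
  intro he; destruct (geom_small (/ 2) e) as [N hN]; [lra|exact he|].
  exists N; intros n hn; rewrite <- pow_inv.
  pose proof (geom_le (/ 2) N n ltac:(lra) hn); lra.
Qed.

Lemma integral_code {d} lam th C M (F : Sigma d -> R) mu I x0 k :
  0 < lam < 1 -> 0 < th < 1 -> holder th C F -> (forall x, Rabs (F x) <= M) ->
  prob_measure lam mu -> is_integral mu F I ->
  I <= expect mu (d ^ k) (code k) (fun c => F (decode x0 k c)) + C * th ^ k.
Proof.
  intros hl hth hF hM hmu hI.
  destruct (INR_unbounded M) as [N hN].
  apply (Un_cv_le_const _ _ _ N hI); intros n hn.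
  assert (hn' : M <= INR n) by (apply le_INR in hn; lra).
  destruct (integral_approx_label lam th C M F n hl hth hF hM hn') as [K [a [f [ha [he hf]]]]].
  rewrite (he mu hmu); apply (expect_le lam); auto; [apply label_code; exact hl|].
  intro x; destruct (hf x) as [h1 _].
  pose proof (proj2 hF k _ _ (decode_agree x0 k x)) as h2; apply Rabs_le_bounds in h2; lra.
Qed.

Lemma expect_shift {d} lam mu K k (f : nat -> R) : invariant lam mu -> 0 < lam < 1 ->
  expect mu K (fun x : Sigma d => code k (shift x)) f = expect mu K (code k) f.
Proof.
  intros [_ hinv] hl; unfold expect; apply sum_eq; intros j _; f_equal.
  apply (hinv (fun x => code k x = j)); apply (proj2 (label_code lam k hl)).
Qed.

(* Integrating the cohomological inequality against an invariant measure, with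
   integrals replaced by sums over cylinders of length [k]. *)
Lemma integral_gap {d} lam th C M Cv eps m (F v : Sigma d -> R) mu I x0 k :
  0 < lam < 1 -> 0 < th < 1 -> holder th C F -> (forall x, Rabs (F x) <= M) ->
  holder th Cv v ->
  (forall x, F x - m + v x - v (shift x) <= - eps * orbit_dist th x0 x) ->
  invariant lam mu -> is_integral mu F I ->
  I + eps * expect mu (d ^ k) (code k) (fun c => orbit_dist th x0 (decode x0 k c))
    <= m + (C + Cv / th + Cv) * th ^ k.
Proof.
  intros hl hth hF hM hv hco hinv hI; pose proof (proj1 hinv) as hmu.
  pose proof (integral_code lam th C M F mu I x0 k hl hth hF hM hmu hI) as h1.
  pose proof (label_code (d := d) lam k hl) as hlab.
  set (E := expect mu (d ^ k) (code k)) in *.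
  pose (D := decode x0 k).
  assert (h2 : E (fun c => (F (D c) + eps * orbit_dist th x0 (D c)) + v (D c))
    <= E (fun c => v (shift (D c))) + m).
  { apply (expect_le lam); auto; intro x; specialize (hco (D (code k x))); lra. }
  unfold E in h2; rewrite !expect_plus, expect_scal in h2; fold E in h2.
  (* Invariance enters here: the labels of [x] and of [shift x] have the same distribution.
     [Cv / th] is the error of the representative before the shift, [Cv] the error after it. *)
  assert (h3 : E (fun c => v (shift (D c))) <= E (fun c => v (D c)) + (Cv / th + Cv) * th ^ k).
  { unfold E at 2; rewrite <- (expect_shift lam) by auto.
    apply (expect_le lam); auto; [apply label_code_shift; exact hl|]; intro x.
    pose proof (proj2 (holder_shift th Cv v hth hv) k _ _ (decode_agree x0 k x)) as q1.
    pose proof (proj2 hv k _ _ (decode_agree x0 k (shift x))) as q2.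
    apply Rabs_le_bounds in q1; apply Rabs_le_bounds in q2; unfold D; lra. }
  fold D in h1; unfold D in *; lra.
Qed.

(** * Periodic orbit measures *)

Definition indic {d} (B : Sigma d -> Prop) (x : Sigma d) : R :=
  if excluded_middle_informative (B x) then 1 else 0.

Definition orbit_measure {d} (p : nat) (x0 : Sigma d) (B : Sigma d -> Prop) : R :=
  bsum (indic B) p x0 / INR p.

Lemma indic_true {d} (B : Sigma d -> Prop) x : B x -> indic B x = 1.
Proof. intro h; unfold indic; destruct excluded_middle_informative; tauto. Qed.

Lemma indic_false {d} (B : Sigma d -> Prop) x : ~ B x -> indic B x = 0.
Proof. intro h; unfold indic; destruct excluded_middle_informative; tauto. Qed.

Lemma indic_ext {d} (B B' : Sigma d -> Prop) x y : (B x <-> B' y) -> indic B x = indic B' y.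
Proof.
  intro h; destruct (classic (B x)) as [hb|hb].
  - rewrite !indic_true; tauto.
  - rewrite !indic_false; tauto.
Qed.

Lemma indic_nonneg {d} (B : Sigma d -> Prop) x : 0 <= indic B x.
Proof. unfold indic; destruct excluded_middle_informative; lra. Qed.

Lemma sum_single (f : nat -> R) K j : (j <= K)%nat ->
  (forall n, n <> j -> f n = 0) -> sum_f_R0 f K = f j.
Proof.
  intros hj h; induction K as [|K IH]; [replace j with 0%nat by lia; reflexivity|].
  simpl; destruct (Nat.eq_dec j (S K)) as [->|hne].
  - rewrite (sum_eq f (fun _ => 0)) by (intros; apply h; lia).
    rewrite sum_cte; ring.
  - rewrite IH, (h (S K)) by lia; ring.
Qed.

Lemma bsum_indic_sigma_additive {d} (B : nat -> Sigma d -> Prop) p x :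
  (forall n m y, n <> m -> B n y -> B m y -> False) ->
  infinite_sum (fun n => bsum (indic (B n)) p x) (bsum (indic (fun y => exists n, B n y)) p x).
Proof.
  intro hdis; revert x; induction p as [|p IH]; intro x; simpl.
  - apply (infinite_sum_finite (fun _ => 0) 0); auto.
  - assert (h : infinite_sum (fun n => indic (B n) x) (indic (fun y => exists n, B n y) x)).
    { destruct (classic (exists n, B n x)) as [[j hj]|hno].
      - rewrite (indic_true _ x) by eauto.
        replace 1 with (sum_f_R0 (fun n => indic (B n) x) j).
        + apply infinite_sum_finite; intros n hn; apply indic_false; intro hc.
          apply (hdis n j x); auto; lia.
        + rewrite (sum_single _ j j); [apply indic_true; exact hj|lia|].
          intros n hn; apply indic_false; intro hc; apply (hdis n j x); auto.
      - rewrite (indic_false _ x) by exact hno.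
        replace 0 with (sum_f_R0 (fun n => indic (B n) x) 0)
          by (simpl; apply indic_false; eauto).
        apply infinite_sum_finite; intros n _; apply indic_false; eauto. }
    pose proof (CV_plus _ _ _ _ h (IH (shift x))) as hc.
    apply (Un_cv_ext (fun n => sum_f_R0 (fun n => indic (B n) x) n +
      sum_f_R0 (fun n => bsum (indic (B n)) p (shift x)) n)); [|exact hc].
    intro n; symmetry; apply sum_plus.
Qed.

Lemma orbit_measure_prob {d} lam p (x0 : Sigma d) : (1 <= p)%nat ->
  prob_measure lam (orbit_measure p x0).
Proof.
  intro hp; assert (hp0 : 0 < INR p) by (apply lt_0_INR; lia).
  assert (hpi : 0 < / INR p) by (apply Rinv_0_lt_compat; exact hp0).
  split; [|split; [|split]].
  - intros B B' h; unfold orbit_measure; f_equal; apply bsum_ext; intro y.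
    apply indic_ext; auto.
  - intros B _; apply Rmult_le_pos; [|lra].
    rewrite <- (Rmult_0_r (INR p)); apply bsum_ge_const; intros; apply indic_nonneg.
  - unfold orbit_measure; rewrite (bsum_ext _ (fun _ => 1)) by (intro; apply indic_true; auto).
    rewrite bsum_const; field; lra.
  - intros B _ hdis; unfold orbit_measure.
    (* The explicit term proves that the constant sequence [/ INR p] converges. *)
    pose proof (CV_mult (fun _ => / INR p) _ _ _
      (fun e he => ex_intro _ 0%nat (fun n _ => eq_ind_r (fun r => r < e) he (Rdist_eq (/ INR p))))
      (bsum_indic_sigma_additive B p x0 hdis)) as h.
    unfold Rdiv; rewrite Rmult_comm; eapply Un_cv_ext; [|exact h].
    intro n; cbv beta; rewrite scal_sum; reflexivity.
Qed.

Lemma bsum_shift {d} (A : Sigma d -> R) p x :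
  bsum (fun y => A (shift y)) p x = bsum A p (shift x).
Proof. revert x; induction p as [|p IH]; intro x; simpl; [|rewrite IH]; reflexivity. Qed.

Lemma orbit_measure_invariant {d} lam p (x0 : Sigma d) : (1 <= p)%nat ->
  shift_by p x0 = x0 -> invariant lam (orbit_measure p x0).
Proof.
  intros hp hx; split; [apply orbit_measure_prob; exact hp|].
  intros B _; unfold orbit_measure; f_equal.
  rewrite (bsum_ext (indic (fun x => B (shift x))) (fun y => indic B (shift y)))
    by (intro; apply indic_ext; tauto).
  rewrite bsum_shift; apply (bsum_rotate _ _ _ hx 1).
Qed.

Lemma expect_orbit_measure {d} lam p (x0 : Sigma d) K a f : label lam K a -> (1 <= p)%nat ->
  expect (orbit_measure p x0) K a f = bsum (fun x => f (a x)) p x0 / INR p.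
Proof.
  intros [hK _] hp; unfold expect, orbit_measure.
  assert (h : forall x, sum_f_R0 (fun j => f j * bsum (indic (fun y => a y = j)) p x) K
    = bsum (fun y => f (a y)) p x).
  { induction p as [|p IH]; intro x.
    - rewrite (sum_eq _ (fun _ => 0)) by (intros; simpl; ring); rewrite sum_cte; simpl; ring.
    - simpl.
      rewrite (sum_eq _ (fun j => f j * indic (fun y => a y = j) x
        + f j * bsum (indic (fun y => a y = j)) p (shift x))) by (intros; ring).
      rewrite sum_plus; f_equal.
      + rewrite (sum_single _ K (a x)); [rewrite indic_true by reflexivity; ring|apply hK|].
        intros n hn; rewrite indic_false by congruence; ring.
      + destruct p as [|p]; [|apply IH; lia].
        rewrite (sum_eq _ (fun _ => 0)) by (intros; simpl; ring); rewrite sum_cte; simpl; ring. }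
  rewrite <- h; unfold Rdiv; rewrite Rmult_comm, scal_sum; apply sum_eq; intros; ring.
Qed.

Lemma orbit_measure_integral {d} lam th C M (F : Sigma d -> R) p x0 :
  0 < lam < 1 -> 0 < th < 1 -> holder th C F -> (forall x, Rabs (F x) <= M) -> (1 <= p)%nat ->
  is_integral (orbit_measure p x0) F (bsum F p x0 / INR p).
Proof.
  intros hl hth hF hM hp e he.
  assert (hp0 : 0 < INR p) by (apply lt_0_INR; lia).
  destruct (INR_unbounded M) as [N hN]; destruct (half_pow_small e he) as [N' hN'].
  exists (max N N'); intros n hn.
  assert (hn' : M <= INR n) by (assert (INR N <= INR n) by (apply le_INR; lia); lra).
  destruct (integral_approx_label lam th C M F n hl hth hF hM hn') as [K [a [f [ha [hex hf]]]]].
  rewrite (hex _ (orbit_measure_prob lam p x0 hp)), (expect_orbit_measure lam) by auto.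
  assert (h1 : bsum (fun x => f (a x)) p x0 <= bsum F p x0)
    by (apply bsum_le; intros; apply hf).
  assert (h2 : bsum F p x0 <= bsum (fun x => f (a x)) p x0 + INR p * / 2 ^ n).
  { rewrite <- (bsum_const (/ 2 ^ n) p x0), <- bsum_plus; apply bsum_le; intros; apply hf. }
  specialize (hN' n ltac:(lia)); unfold Rdist.
  replace (bsum (fun x => f (a x)) p x0 / INR p - bsum F p x0 / INR p)
    with (- ((bsum F p x0 - bsum (fun x => f (a x)) p x0) / INR p)) by (field; lra).
  rewrite Rabs_Ropp, Rabs_right.
  - apply Rle_lt_trans with (/ 2 ^ n); [|exact hN'].
    apply (Rmult_le_reg_r (INR p)); [exact hp0|].
    unfold Rdiv; rewrite Rmult_assoc, Rinv_l by lra; lra.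
  - apply Rle_ge, Rmult_le_pos; [lra|left; apply Rinv_0_lt_compat; exact hp0].
Qed.

(** * Invariant measures carried by a periodic orbit *)

Lemma measure_mono {d} lam mu (A B : Sigma d -> Prop) : 0 < lam < 1 -> prob_measure lam mu ->
  borel lam A -> borel lam B -> (forall x, A x -> B x) -> mu A <= mu B.
Proof.
  intros hl hmu hA hB hAB; pose proof hmu as [hext [hpos _]].
  pose (a := fun x => if excluded_middle_informative (A x) then 1%nat else 0%nat).
  assert (h1 : forall x, a x = 1%nat <-> A x)
    by (intro x; unfold a; destruct excluded_middle_informative; split; intro; tauto || lia).
  assert (h0 : forall x, a x = 0%nat <-> ~ A x)
    by (intro x; unfold a; destruct excluded_middle_informative; split; intro; tauto || lia).
  assert (ha : label lam 1 a).
  { split; [intro x; unfold a; destruct excluded_middle_informative; lia|].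
    intros [|[|j]].
    - apply borel_ext with (fun x => ~ A x); [apply borel_compl; exact hA|].
      intro; symmetry; apply h0.
    - apply borel_ext with A; [exact hA|]; intro; symmetry; apply h1.
    - apply (borel_cylinder lam 0); auto; intros x y _ hx; unfold a in hx.
      destruct excluded_middle_informative in hx; lia. }
  rewrite (measure_partition lam mu 1 a B hmu ha hB); simpl.
  rewrite (hext (fun x => B x /\ a x = 1%nat) A)
    by (intro x; rewrite h1; split; [tauto|auto]).
  assert (0 <= mu (fun x => B x /\ a x = 0%nat)) by (apply hpos, borel_and; [exact hB|apply ha]).
  lra.
Qed.

Lemma borel_near {d} lam (x0 : Sigma d) n : 0 < lam < 1 -> borel lam (near x0 n).
Proof.
  intro hl; apply (borel_cylinder lam n); auto.
  intros x y h; apply near_agree, agree_sym, h.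
Qed.

(** Off the orbit every point lies in exactly one shell [D n], according to when it leaves the
    orbit; each shell is null. *)
Lemma measure_orbit_compl {d} lam mu p (x0 : Sigma d) B : 0 < lam < 1 -> prob_measure lam mu ->
  (1 <= p)%nat -> shift_by p x0 = x0 -> borel lam B ->
  (forall n, mu (fun x => ~ near x0 (S n) x) = 0) ->
  (forall x, B x -> forall i, (i < p)%nat -> x <> shift_by i x0) -> mu B = 0.
Proof.
  intros hl hmu hp hx0 hB hW hno; pose proof hmu as [hext [hpos [_ hadd]]].
  pose (D := fun n x => near x0 n x /\ ~ near x0 (S n) x).
  assert (hD : forall n, borel lam (D n))
    by (intro n; apply borel_and; [|apply borel_compl]; apply borel_near; exact hl).
  assert (hDU : mu (fun x => exists n, D n x) = 0).
  { apply infinite_sum_unique with (fun n => mu (D n)).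
    - apply hadd; [exact hD|]; intros n m x hnm [a1 a2] [b1 b2].
      destruct (Nat.lt_total n m) as [h|[h|h]]; [|lia|].
      + apply a2; eapply near_le; [|exact b1]; lia.
      + apply b2; eapply near_le; [|exact a1]; lia.
    - assert (hz : forall n, mu (D n) = 0).
      { intro n; apply Rle_antisym; [|apply hpos, hD].
        rewrite <- (hW n); apply (measure_mono lam); auto.
        - apply borel_compl, borel_near; exact hl.
        - intros x [_ h]; exact h. }
      rewrite <- (hz 0%nat); apply (infinite_sum_finite (fun n => mu (D n)) 0); auto. }
  apply Rle_antisym; [|apply hpos; exact hB].
  rewrite <- hDU; apply (measure_mono lam); auto; [apply borel_union; exact hD|].
  intros x hx; apply NNPP; intro hc.
  destruct (near_all p x0 x hp hx0) as [i [hi hxi]]; [|exact (hno x hx i hi hxi)].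
  intro n; apply NNPP; intro hn; apply hc.
  destruct (near_last x0 x n hn) as [t [_ ht]]; exists t; exact ht.
Qed.

Lemma sum_bsum {d} (A : Sigma d -> R) n x :
  sum_f_R0 (fun i => A (shift_by i x)) n = bsum A (S n) x.
Proof.
  induction n as [|n IH]; [simpl; rewrite shift_by_0; ring|].
  replace (S (S n)) with (S n + 1)%nat by lia; rewrite bsum_add, <- IH; simpl; ring.
Qed.

(** A point lies in the preimage of its image, so invariant point masses can only grow along the
    orbit. After one period they are back, hence equal, and the minimal period makes the [p] points
    distinct. *)
Lemma measure_unique {d} lam mu p (x0 : Sigma d) : 0 < lam < 1 -> invariant lam mu ->
  (1 <= p)%nat -> shift_by p x0 = x0 -> (forall i, (1 <= i < p)%nat -> shift_by i x0 <> x0) ->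
  (forall n, mu (fun x => ~ near x0 (S n) x) = 0) ->
  forall B, borel lam B -> mu B = orbit_measure p x0 B.
Proof.
  intros hl [hmu hinv] hp hx0 hmin hW; pose proof hmu as [hext [hpos [h1 _]]].
  assert (hinj : forall i j, (i < p)%nat -> (j < p)%nat -> shift_by i x0 = shift_by j x0 -> i = j).
  { assert (hlt : forall i j, (i < j < p)%nat -> shift_by i x0 <> shift_by j x0).
    { intros i j hij h; apply (hmin (j - i)%nat); [lia|].
      apply (f_equal (shift_by (p - i))) in h; rewrite !shift_by_add in h.
      replace (i + (p - i))%nat with p in h by lia.
      replace (j + (p - i))%nat with (p + (j - i))%nat in h by lia.
      rewrite <- shift_by_add, hx0 in h; congruence. }
    intros i j hi hj h; destruct (Nat.lt_total i j) as [q|[q|q]]; auto; exfalso.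
    - exact (hlt i j ltac:(lia) h).
    - exact (hlt j i ltac:(lia) (eq_sym h)). }
  pose (w := fun i => mu (fun x => x = shift_by i x0)).
  assert (hw : forall i, w i <= w (S i)).
  { intro i; unfold w; rewrite <- (hinv (fun x => x = shift_by (S i) x0))
      by (apply borel_point; exact hl).
    apply (measure_mono lam); auto; [apply borel_point; exact hl| |].
    - apply borel_fiber; auto; intros n x z h; apply (agree_shift_by 1 n); exact h.
    - intros x ->; apply shift_shift_by. }
  assert (hw0 : forall i, w 0%nat <= w i).
  { induction i as [|i IH]; [lra|]; specialize (hw i); lra. }
  assert (hwp : forall i k, w i <= w (i + k)%nat).
  { intros i k; induction k as [|k IH]; [rewrite Nat.add_0_r; lra|].
    rewrite Nat.add_succ_r; specialize (hw (i + k)%nat); lra. }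
  assert (hweq : forall i, (i < p)%nat -> w i = w 0%nat).
  { intros i hi; apply Rle_antisym; [|apply hw0].
    specialize (hwp i (p - i)%nat); replace (i + (p - i))%nat with p in hwp by lia.
    unfold w in hwp at 2; rewrite hx0 in hwp; exact hwp. }
  (* Label [p] collects everything off the orbit. *)
  pose (Q := fun x i => (i < p)%nat /\ x = shift_by i x0 \/
    i = p /\ forall j, (j < p)%nat -> x <> shift_by j x0).
  assert (hQex : forall x, exists i, Q x i).
  { intro x; destruct (classic (exists i, (i < p)%nat /\ x = shift_by i x0)) as [[i hi]|hno].
    - exists i; left; exact hi.
    - exists p; right; split; [reflexivity|]; intros j hj hx; apply hno; exists j; auto. }
  pose (a := fun x => epsilon (inhabits 0%nat) (Q x)).
  assert (haQ : forall x, Q x (a x)) by (intro x; apply epsilon_spec, hQex).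
  assert (ha : forall x i, a x = i <-> Q x i).
  { intros x i; split; [intros <-; apply haQ|]; intro hi.
    destruct (haQ x) as [[q1 q2]|[q1 q2]], hi as [[r1 r2]|[r1 r2]].
    - apply hinj; congruence.
    - exfalso; exact (r2 _ q1 q2).
    - exfalso; exact (q2 _ r1 r2).
    - congruence. }
  assert (hlab : label lam p a).
  { split.
    - intro x; destruct (haQ x) as [[q _]|[q _]]; lia.
    - assert (hpt : forall i, (i < p)%nat -> borel lam (fun x => a x = i)).
      { intros i hi; apply borel_ext with (fun x => x = shift_by i x0);
          [apply borel_point; exact hl|].
        intro x; rewrite ha; unfold Q; split; [auto|intros [[_ h]|[h _]]; [exact h|lia]]. }
      intro i; destruct (Nat.lt_total i p) as [h|[h|h]]; [apply hpt; exact h| |].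
      + subst i; apply borel_ext with (fun x => ~ exists n, (n < p)%nat /\ a x = n).
        * apply borel_compl, borel_union; intro n.
          destruct (Nat.lt_ge_cases n p) as [hn|hn].
          -- apply borel_ext with (fun x => a x = n); [apply hpt; exact hn|intro; tauto].
          -- apply (borel_cylinder lam 0); auto; intros x y _ [h _]; lia.
        * intro x; split; [|intros h [n [hn hn']]; lia].
          intro h; destruct (haQ x) as [[q _]|[q _]]; [|exact q].
          exfalso; apply h; exists (a x); auto.
      + apply (borel_cylinder lam 0); auto; intros x y _ hx.
        destruct (haQ x) as [[q _]|[q _]]; lia. }
  assert (hdec : forall B, borel lam B -> mu B = bsum (indic B) p x0 * w 0%nat).
  { intros B hB; rewrite (measure_partition lam mu p a B hmu hlab hB).
    destruct p as [|p']; [lia|]; rewrite tech5.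
    rewrite (measure_orbit_compl lam mu (S p') x0 (fun x => B x /\ a x = S p')); auto.
    - rewrite Rplus_0_r, <- sum_bsum, Rmult_comm, scal_sum; apply sum_eq; intros i hi.
      assert (hai : forall x, a x = i <-> x = shift_by i x0).
      { intro x; rewrite ha; unfold Q; split; [intros [[_ h]|[h _]]; [exact h|lia]|].
        intro h; left; split; [lia|exact h]. }
      destruct (classic (B (shift_by i x0))) as [h|h].
      + rewrite indic_true, Rmult_1_l by exact h.
        rewrite <- (hweq i) by lia; apply hext; intro x; rewrite hai.
        split; [tauto|intros ->; auto].
      + rewrite indic_false, Rmult_0_l by exact h; apply (measure_empty lam); auto.
        intros x [q1 q2]; apply hai in q2; subst x; auto.
    - apply borel_and; [exact hB|apply hlab].
    - intros x [_ hx] i hi; apply ha in hx; destruct hx as [[q _]|[_ q]]; [lia|auto]. }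
  assert (hp0 : 0 < INR p) by (apply lt_0_INR; lia).
  assert (hw1 : INR p * w 0%nat = 1).
  { rewrite <- h1, hdec by (apply (borel_cylinder lam 0); auto).
    rewrite (bsum_ext _ (fun _ => 1)) by (intro; apply indic_true; auto).
    rewrite bsum_const; ring. }
  intros B hB; rewrite hdec by exact hB; unfold orbit_measure.
  apply (Rmult_eq_reg_r (INR p)); [|lra].
  unfold Rdiv; rewrite !Rmult_assoc, Rinv_l by lra; rewrite (Rmult_comm (w 0%nat)), hw1; ring.
Qed.

Lemma small_geom_bound a b D th : 0 < th < 1 ->
  (forall k, a <= b + D * th ^ k) -> a <= b.
Proof.
  intros hth h; apply Rnot_lt_le; intro hlt.
  destruct (geom_small th ((a - b) / (Rabs D + 1)) hth) as [k hk].
  { pose proof (Rabs_pos D); apply Rmult_lt_0_compat; [lra|apply Rinv_0_lt_compat; lra]. }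
  pose proof (Rabs_pos D); pose proof (Rle_abs D); pose proof (geom_pos th k hth).
  apply (Rmult_lt_compat_l (Rabs D + 1)) in hk; [|lra].
  replace ((Rabs D + 1) * ((a - b) / (Rabs D + 1))) with (a - b) in hk by (field; lra).
  specialize (h k); nra.
Qed.

Lemma expect_orbit_dist_nonneg {d} lam th (mu : (Sigma d -> Prop) -> R) (x0 : Sigma d) k : 0 < lam < 1 -> 0 < th < 1 ->
  prob_measure lam mu ->
  0 <= expect mu (d ^ k) (code k) (fun c => orbit_dist th x0 (decode x0 k c)).
Proof.
  intros hl hth hmu; unfold expect; apply cond_pos_sum; intro j.
  apply Rmult_le_pos; [apply orbit_dist_nonneg; exact hth|].
  apply (proj1 (proj2 hmu)); apply (label_code lam k hl).
Qed.

(** Markov's inequality for the distance to the orbit; [th ^ k] is the error of the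
    representatives. *)
Lemma far_measure_le {d} lam th mu (x0 : Sigma d) n k : 0 < lam < 1 -> 0 < th < 1 ->
  prob_measure lam mu ->
  th ^ n * mu (fun x => ~ near x0 (S n) x) <=
    expect mu (d ^ k) (code k) (fun c => orbit_dist th x0 (decode x0 k c)) + th ^ k.
Proof.
  intros hl hth hmu.
  pose (a := fun x => if excluded_middle_informative (near x0 (S n) x) then 0%nat else 1%nat).
  pose (f := fun j => match j with O => 0 | _ => th ^ n end).
  assert (ha1 : forall x, a x = 1%nat <-> ~ near x0 (S n) x)
    by (intro x; unfold a; destruct excluded_middle_informative; split; intro; tauto || lia).
  assert (hlab : label lam 1 a).
  { split; [intro x; unfold a; destruct excluded_middle_informative; lia|].
    intro j; apply (borel_cylinder lam (S n)); auto; intros x y hxy <-; unfold a.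
    assert (near x0 (S n) x <-> near x0 (S n) y)
      by (split; apply near_agree; [apply agree_sym|]; exact hxy).
    destruct excluded_middle_informative, excluded_middle_informative; tauto. }
  pose proof (expect_le lam mu 1 (d ^ k) a (code k) f
    (fun c => orbit_dist th x0 (decode x0 k c)) (th ^ k) hmu hlab (label_code lam k hl)) as h.
  unfold expect at 1 in h; simpl in h.
  rewrite (proj1 hmu (fun x => a x = 1%nat) (fun x => ~ near x0 (S n) x) ha1) in h.
  rewrite Rmult_0_l, Rplus_0_l in h; apply h; intro x.
  pose proof (proj2 (orbit_dist_holder th x0 hth) k _ _ (decode_agree x0 k x)) as q.
  rewrite Rmult_1_l in q; apply Rabs_le_bounds in q.
  pose proof (orbit_dist_nonneg th x0 x hth).
  unfold a, f; destruct excluded_middle_informative as [hn|hn]; [lra|].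
  pose proof (orbit_dist_far th x0 x n hth hn); lra.
Qed.

Lemma not_orbit_dist_pos {d} th p (x0 x : Sigma d) : 0 < th < 1 -> (1 <= p)%nat ->
  shift_by p x0 = x0 -> (forall i, (i < p)%nat -> x <> shift_by i x0) ->
  exists n, ~ near x0 (S n) x.
Proof.
  intros hth hp hx0 h; apply NNPP; intro hno.
  destruct (near_all p x0 x hp hx0) as [i [hi hxi]]; [|exact (h i hi hxi)].
  intro n; apply (near_le x0 x n (S n)); [lia|]; apply NNPP; intro hc; apply hno; exists n; exact hc.
Qed.

Lemma support_orbit_measure {d} lam p (x0 x : Sigma d) : 0 < lam < 1 -> (1 <= p)%nat ->
  shift_by p x0 = x0 ->
  support lam (orbit_measure p x0) x <-> exists i, (i < p)%nat /\ x = shift_by i x0.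
Proof.
  intros hl hp hx0; assert (hp0 : 0 < INR p) by (apply lt_0_INR; lia); split.
  - intro hs; apply NNPP; intro hno.
    destruct (not_orbit_dist_pos (/ 2) p x0 x ltac:(lra) hp hx0) as [n hn].
    { intros i hi hxi; apply hno; exists i; auto. }
    specialize (hs (agree (S n) x)).
    assert (hs' : 0 < orbit_measure p x0 (agree (S n) x)).
    { apply hs; [|intros k _; reflexivity].
      apply is_open_agree; auto; intros y hy; exists (S n); intros z hz.
      eapply agree_trans; eauto. }
    unfold orbit_measure in hs'.
    assert (bsum (indic (agree (S n) x)) p x0 <= INR p * 0).
    { apply bsum_le_const; intros i hi; rewrite indic_false; [lra|].
      intro hag; apply hn; exists i; exact hag. }
    rewrite Rmult_0_r in H; apply (Rmult_lt_compat_r (INR p)) in hs'; [|exact hp0].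
    unfold Rdiv in hs'; rewrite Rmult_assoc, Rinv_l in hs'; lra.
  - intros [i [hi ->]] V _ hV; unfold orbit_measure.
    apply Rmult_lt_0_compat; [|apply Rinv_0_lt_compat; exact hp0].
    rewrite <- (bsum_rotate _ _ _ hx0 i).
    replace p with (1 + (p - 1))%nat by lia; rewrite bsum_add; simpl.
    rewrite indic_true by exact hV.
    assert (INR (p - 1) * 0 <= bsum (indic V) (p - 1) (shift (shift_by i x0)))
      by (apply bsum_ge_const; intros; apply indic_nonneg).
    change (shift_by 1 (shift_by i x0)) with (shift (shift_by i x0)); lra.
Qed.

(** * Uniqueness and the Aubry set from the strict inequality *)

Lemma sum_iter_shift {d} (F : Sigma d -> R) m n z : (1 <= n)%nat ->
  sum_f_R0 (fun i => F (Nat.iter i shift z) - m) (n - 1) = bsum (fun y => F y + - m) n z.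
Proof.
  intro hn; destruct n as [|n]; [lia|].
  rewrite <- sum_bsum; replace (S n - 1)%nat with n by lia.
  apply sum_eq; intros i _; rewrite iter_shift; ring.
Qed.

(** The inequality is used twice. Integrated, it bounds all integrals by [m], and equality forces
    zero distance to the orbit almost everywhere. Summed along an orbit piece that returns to [x],
    it bounds the Mañé potential at [(x, x)] by [- eps * orbit_dist th x0 x]. *)
Lemma setR_of_cohomology {d} lam th C M Cv eps (F v : Sigma d -> R) p x0 :
  0 < lam < 1 -> 0 < th < 1 -> holder th C F -> (forall x, Rabs (F x) <= M) -> holder th Cv v ->
  0 < eps -> (1 <= p)%nat -> shift_by p x0 = x0 ->
  (forall i, (1 <= i < p)%nat -> shift_by i x0 <> x0) ->
  (forall x, F x - bsum F p x0 / INR p + v x - v (shift x) <= - eps * orbit_dist th x0 x) ->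
  setR lam F.
Proof.
  intros hl hth hF hM hv heps hp hx0 hmin hco.
  set (m := bsum F p x0 / INR p) in *.
  assert (hp0 : 0 < INR p) by (apply lt_0_INR; lia).
  pose (D := C + Cv / th + Cv).
  assert (hup : forall mu I, invariant lam mu -> is_integral mu F I -> I <= m).
  { intros mu I hinv hI; apply small_geom_bound with D th; [exact hth|]; intro k.
    pose proof (integral_gap lam th C M Cv eps m F v mu I x0 k hl hth hF hM hv hco hinv hI) as h.
    pose proof (expect_orbit_dist_nonneg lam th mu x0 k hl hth (proj1 hinv)).
    fold D in h; nra. }
  pose proof (orbit_measure_invariant lam p x0 hp hx0) as hinv0.
  pose proof (orbit_measure_integral lam th C M F p x0 hl hth hF hM hp) as hint0; fold m in hint0.
  assert (hlub : is_lub (fun r => exists mu, invariant lam mu /\ is_integral mu F r) m).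
  { split; [intros r [mu [h1 h2]]; eapply hup; eauto|].
    intros b hb; apply hb; exists (orbit_measure p x0); split; assumption. }
  assert (hmA : mA lam F = m).
  { unfold mA; eapply is_lub_u; [|exact hlub]; apply epsilon_spec; exists m; exact hlub. }
  (* Only the penalty at the starting point [z] is kept. It stays away from zero when [z] is close
     to a point off the orbit. *)
  assert (hmane : forall x n z, (1 <= n)%nat -> same (Nat.iter n shift z) x ->
    sum_f_R0 (fun i => F (Nat.iter i shift z) - mA lam F) (n - 1)
      <= - eps * orbit_dist th x0 z + v x - v z).
  { intros x n z hn hx; rewrite hmA.
    rewrite sum_iter_shift by exact hn.
    rewrite iter_shift in hx; apply same_eq in hx; rewrite <- hx.
    assert (h1 : bsum (fun y => F y + - m) n z + (v z - v (shift_by n z))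
      <= - eps * orbit_dist th x0 z); [|lra].
    rewrite <- bsum_coboundary, <- bsum_plus.
    destruct n as [|n]; [lia|]; simpl.
    assert (h2 : bsum (fun y => F y + - m + (v y - v (shift y))) n (shift z) <= INR n * 0).
    { apply bsum_le_const; intros i _; specialize (hco (shift_by i (shift z))).
      pose proof (orbit_dist_nonneg th x0 (shift_by i (shift z)) hth); nra. }
    specialize (hco z); lra. }
  exists (orbit_measure p x0); split; [|split].
  - split; [exact hinv0|rewrite hmA; exact hint0].
  - intros nu [hinv hint] B hB; rewrite hmA in hint.
    apply (measure_unique lam); auto; intro n.
    pose proof (proj1 hinv) as hmu.
    apply Rle_antisym;
      [|apply (proj1 (proj2 hmu)), borel_compl, borel_near; exact hl].
    apply (Rmult_le_reg_l (th ^ n)); [apply geom_pos; exact hth|]; rewrite Rmult_0_r.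
    apply small_geom_bound with (D / eps + 1) th; [exact hth|]; intro k.
    pose proof (integral_gap lam th C M Cv eps m F v nu m x0 k hl hth hF hM hv hco hinv hint) as h.
    fold D in h; pose proof (far_measure_le lam th nu x0 n k hl hth hmu) as h'.
    set (E := expect nu (d ^ k) (code k) (fun c => orbit_dist th x0 (decode x0 k c))) in *.
    assert (E <= D / eps * th ^ k).
    { apply (Rmult_le_reg_l eps); [exact heps|].
      replace (eps * (D / eps * th ^ k)) with (D * th ^ k) by (field; lra); lra. }
    lra.
  - intro x; rewrite support_orbit_measure by assumption; split.
    + intro haub; apply NNPP; intro hno.
      destruct (not_orbit_dist_pos th p x0 x hth hp hx0) as [n hn].
      { intros i hi hxi; apply hno; exists i; auto. }
      pose proof (orbit_dist_far th x0 x n hth hn) as hfar.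
      pose proof (geom_pos th n hth) as hpos.
      destruct (haub (eps * th ^ n / 2)) as [delta [hd hlubs]];
        [apply Rmult_lt_0_compat; [apply Rmult_lt_0_compat|]; lra|].
      (* Replacing [z] by [x] costs [Cv * th ^ k] in [v] and [eps * th ^ k] in the penalty; half of
         [eps * th ^ n] has to remain. *)
      destruct (geom_small th (eps * th ^ n / 2 / (Cv + eps + 1)) hth) as [k hk].
      { destruct hv; apply Rmult_lt_0_compat; [|apply Rinv_0_lt_compat; lra].
        apply Rmult_lt_0_compat; [apply Rmult_lt_0_compat|]; lra. }
      assert (hk' : (Cv + eps) * th ^ k <= eps * th ^ n / 2).
      { destruct hv; apply (Rmult_lt_compat_l (Cv + eps + 1)) in hk; [|lra].
        replace ((Cv + eps + 1) * (eps * th ^ n / 2 / (Cv + eps + 1))) with (eps * th ^ n / 2)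
          in hk by (field; lra).
        pose proof (geom_pos th k hth); nra. }
      pose (e := Rmin (delta / 2) (lam ^ k)).
      assert (hlk : 0 < lam ^ k) by (apply geom_pos; exact hl).
      assert (he : 0 < e < delta).
      { unfold e; split; [apply Rmin_glb_lt; lra|].
        eapply Rle_lt_trans; [apply Rmin_l|lra]. }
      destruct (hlubs e he) as [s [hs hs']].
      assert (s <= - (eps * th ^ n / 2)); [|apply Rabs_def2 in hs'; lra].
      apply hs; intros r [l [z [hl1 [hl2 [hl3 ->]]]]].
      assert (hag : agree k z x).
      { apply (dist_agree lam); auto; eapply Rlt_le_trans; [exact hl3|apply Rmin_r]. }
      eapply Rle_trans; [apply (hmane x l z); auto|].
      pose proof (proj2 hv k _ _ hag) as q1; apply Rabs_le_bounds in q1.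
      pose proof (proj2 (orbit_dist_holder th x0 hth) k _ _ hag) as q2.
      apply Rabs_le_bounds in q2; rewrite Rmult_1_l in q2; nra.
    + intros [i [hi ->]] eta heta; set (x := shift_by i x0).
      assert (hx : shift_by p x = x).
      { unfold x; rewrite shift_by_add, Nat.add_comm, <- shift_by_add, hx0; reflexivity. }
      destruct (geom_small th (eta / (Cv + 1)) hth) as [k hk].
      { destruct hv; apply Rmult_lt_0_compat; [lra|apply Rinv_0_lt_compat; lra]. }
      assert (hk' : Cv * th ^ k < eta).
      { destruct hv; apply (Rmult_lt_compat_l (Cv + 1)) in hk; [|lra].
        replace ((Cv + 1) * (eta / (Cv + 1))) with eta in hk by (field; lra).
        pose proof (geom_pos th k hth); nra. }
      exists (lam ^ k); split; [apply geom_pos; exact hl|]; intros e he.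
      assert (hub : is_upper_bound (mane_set lam F x x e) (Cv * th ^ k)).
      { intros r [l [z [hl1 [hl2 [hl3 ->]]]]].
        assert (hag : agree k z x) by (apply (dist_agree lam); auto; lra).
        eapply Rle_trans; [apply (hmane x l z); auto|].
        pose proof (proj2 hv k _ _ hag) as q1; apply Rabs_le_bounds in q1.
        pose proof (orbit_dist_nonneg th x0 z hth); nra. }
      (* One full period is an exact return with sum zero, so the supremum lies between [0] and
         [Cv * th ^ k]. *)
      assert (hz : mane_set lam F x x e 0).
      { exists p, x; split; [exact hp|split; [|split]].
        - rewrite iter_shift, hx; intro; reflexivity.
        - unfold Defs.dist; destruct excluded_middle_informative as [hs|hs]; [lra|].
          exfalso; apply hs; intro; reflexivity.
        - rewrite hmA.
          rewrite sum_iter_shift by exact hp.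
          rewrite bsum_plus, bsum_const; unfold x; rewrite bsum_rotate by exact hx0.
          unfold m; field; lra. }
      destruct (completeness (mane_set lam F x x e)) as [s hs];
        [exists (Cv * th ^ k); exact hub|exists 0; exact hz|].
      exists s; split; [exact hs|].
      pose proof (proj1 hs 0 hz); pose proof (proj2 hs _ hub).
      rewrite Rabs_right; lra.
Qed.

(** * Residuality *)

Lemma Rpower_base_lt1 lam alpha : 0 < lam < 1 -> 0 < alpha -> 0 < Rpower lam alpha < 1.
Proof.
  intros hl ha; split; [apply exp_pos|].
  unfold Rpower; rewrite <- exp_0; apply exp_increasing.
  pose proof (ln_increasing lam 1 ltac:(lra) ltac:(lra)) as h; rewrite ln_1 in h; nra.
Qed.

Lemma Rpower_pow_swap lam alpha n : 0 < lam -> Rpower (lam ^ n) alpha = Rpower lam alpha ^ n.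
Proof.
  intro hl; rewrite <- !Rpower_pow, !Rpower_mult, Rmult_comm; auto; apply exp_pos.
Qed.

Lemma Rpower_dist {d} lam alpha (x y : Sigma d) : 0 < lam -> ~ same x y ->
  Rpower (dist lam x y) alpha = Rpower lam alpha ^ first_diff x y.
Proof.
  intros hl h; unfold dist; destruct excluded_middle_informative; [tauto|].
  apply Rpower_pow_swap; exact hl.
Qed.

Lemma holder_of_dist {d} lam alpha C (F : Sigma d -> R) :
  0 < lam < 1 -> 0 < alpha -> 0 <= C ->
  (forall x y, ~ same x y -> Rabs (F x - F y) <= C * Rpower (dist lam x y) alpha) ->
  holder (Rpower lam alpha) C F.
Proof.
  intros hl ha hC h; pose proof (Rpower_base_lt1 lam alpha hl ha) as hth.
  split; [exact hC|]; intros n x y hxy.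
  destruct (classic (same x y)) as [hs|hs].
  - apply same_eq in hs; subst y; rewrite Rminus_diag, Rabs_R0.
    apply Rmult_le_pos; [exact hC|left; apply geom_pos; exact hth].
  - eapply Rle_trans; [apply h; exact hs|]; rewrite Rpower_dist by (lra || assumption).
    apply Rmult_le_compat_l; [exact hC|]; apply geom_le; [exact hth|].
    apply Nat.nlt_ge; intro hlt; apply (proj1 (first_diff_spec x y hs)), hxy, hlt.
Qed.

Lemma dist_of_holder {d} lam alpha C (F : Sigma d -> R) x y : 0 < lam < 1 ->
  holder (Rpower lam alpha) C F -> ~ same x y ->
  Rabs (F x - F y) <= C * Rpower (dist lam x y) alpha.
Proof.
  intros hl hF hs; rewrite Rpower_dist by (lra || assumption).
  apply hF, first_diff_spec, hs.
Qed.

Lemma is_holder_iff {d} lam alpha (F : Sigma d -> R) : 0 < lam < 1 -> 0 < alpha ->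
  is_holder lam alpha F <->
  exists C M, holder (Rpower lam alpha) C F /\ forall x, Rabs (F x) <= M.
Proof.
  intros hl ha; split.
  - intros [[M hM] [C hC]]; exists (Rmax C 0), M; split; [|exact hM].
    apply holder_of_dist; auto; [apply Rmax_r|]; intros x y hs.
    eapply Rle_trans; [apply hC; exact hs|]; apply Rmult_le_compat_r; [|apply Rmax_l].
    left; apply exp_pos.
  - intros [C [M [hC hM]]]; split; [exists M; exact hM|exists C].
    intros x y hs; apply dist_of_holder; auto.
Qed.

Lemma norm_lt_iff {d} lam alpha (H : Sigma d -> R) e : 0 < lam < 1 -> 0 < alpha ->
  norm_lt lam alpha H e <->
  exists r1 r2, r1 + r2 < e /\ (forall z, Rabs (H z) <= r1) /\ holder (Rpower lam alpha) r2 H.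
Proof.
  intros hl ha; split.
  - intros [r1 [r2 [h0 [h1 [h2 h3]]]]]; exists r1, r2; repeat split; auto.
    apply (holder_of_dist lam alpha r2 H hl ha h0); intros x y hs.
    specialize (h3 x y hs).
    assert (hp : 0 < Rpower (dist lam x y) alpha) by apply exp_pos.
    apply (Rmult_le_compat_r (Rpower (dist lam x y) alpha)) in h3; [|lra].
    unfold Rdiv in h3; rewrite Rmult_assoc, Rinv_l, Rmult_1_r in h3; lra.
  - intros [r1 [r2 [h1 [h2 h3]]]]; exists r1, r2; split; [apply h3|]; split; [exact h1|].
    split; [exact h2|]; intros x y hs.
    assert (hp : 0 < Rpower (dist lam x y) alpha) by apply exp_pos.
    apply (Rmult_le_reg_r (Rpower (dist lam x y) alpha)); [exact hp|].
    unfold Rdiv; rewrite Rmult_assoc, Rinv_l, Rmult_1_r by lra.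
    apply dist_of_holder; auto.
Qed.

Lemma norm_lt_triangle {d} lam alpha (F H : Sigma d -> R) e :
  0 < lam < 1 -> 0 < alpha -> norm_lt lam alpha (fun x => F x - H x) e ->
  exists e', 0 < e' /\ forall G, norm_lt lam alpha (fun x => G x - F x) e' ->
    norm_lt lam alpha (fun x => G x - H x) e.
Proof.
  intros hl ha; rewrite norm_lt_iff by assumption; intros [r1 [r2 [h1 [h2 h3]]]].
  exists (e - r1 - r2); split; [lra|]; intro G; rewrite !norm_lt_iff by assumption.
  intros [s1 [s2 [q1 [q2 q3]]]]; exists (r1 + s1), (r2 + s2); split; [lra|split].
  - intro z; replace (G z - H z) with ((F z - H z) + (G z - F z)) by ring.
    eapply Rle_trans; [apply Rabs_triang|]; specialize (h2 z); specialize (q2 z); lra.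
  - destruct (holder_plus _ _ _ _ _ h3 q3) as [hr hh]; split; [exact hr|].
    intros n x y hxy; specialize (hh n x y hxy).
    replace (G x - H x - (G y - H y))
      with (F x - H x + (G x - F x) - (F y - H y + (G y - F y))) by ring; exact hh.
Qed.

Lemma dense_balls {d} lam alpha e (F : Sigma d -> R) (z0 : Sigma d) :
  0 < lam < 1 -> 0 < alpha -> is_holder lam alpha F -> 0 < e ->
  exists G0 r, is_holder lam alpha G0 /\ norm_lt lam alpha (fun x => G0 x - F x) e /\ 0 < r /\
    forall G, is_holder lam alpha G -> norm_lt lam alpha (fun x => G x - G0 x) r -> setR lam G.
Proof.
  intros hl ha hF he; set (th := Rpower lam alpha).
  assert (hth : 0 < th < 1) by (apply Rpower_base_lt1; auto).
  apply is_holder_iff in hF; auto; destruct hF as [C [M [hF hM]]]; fold th in hF.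
  (* The perturbation has sup norm and Hölder constant at most [2 * eps] each, together
     [4 * eps < e]. *)
  set (eps := e / 5); assert (heps : 0 < eps) by (unfold eps; lra).
  destruct (locking th C M eps F z0 hth hF hM heps) as [x0 [p [r [hp [hx0 [hmin [hr hlock]]]]]]].
  set (G0 := fun x => F x + - (2 * eps) * orbit_dist th x0 x).
  assert (hpsi : forall x, 0 <= orbit_dist th x0 x <= 1).
  { intro x; split; [apply orbit_dist_nonneg; exact hth|].
    apply (orbit_dist_near th x0 x 0 hth); exists 0%nat; intros k hk; lia. }
  assert (habs : Rabs (- (2 * eps)) = 2 * eps) by (rewrite Rabs_Ropp, Rabs_right; lra).
  pose proof (holder_scal th 1 (- (2 * eps)) _ (orbit_dist_holder th x0 hth)) as hpert.
  exists G0, r; split; [|split; [|split; [exact hr|]]].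
  - apply is_holder_iff; auto; exists (C + Rabs (- (2 * eps)) * 1), (M + 2 * eps); split.
    + apply holder_plus; assumption.
    + intro x; unfold G0; eapply Rle_trans; [apply Rabs_triang|].
      specialize (hM x); specialize (hpsi x).
      rewrite Rabs_mult, habs, (Rabs_right (orbit_dist th x0 x)) by lra; nra.
  - apply norm_lt_iff; auto; exists (2 * eps), (Rabs (- (2 * eps)) * 1); split; [|split].
    + rewrite habs; unfold eps; lra.
    + intro z; unfold G0; specialize (hpsi z).
      replace (F z + - (2 * eps) * orbit_dist th x0 z - F z)
        with (- (2 * eps) * orbit_dist th x0 z) by ring.
      rewrite Rabs_mult, habs, (Rabs_right (orbit_dist th x0 z)) by lra; nra.
    + replace (fun x => G0 x - F x) with (fun x => - (2 * eps) * orbit_dist th x0 x);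
        [exact hpert|].
      apply functional_extensionality; intro x; unfold G0; ring.
  - intros G hG hGG0; apply is_holder_iff in hG; auto; destruct hG as [CG [MG [hG hMG]]].
    apply norm_lt_iff in hGG0; auto; destruct hGG0 as [r1 [r2 [hr12 [hr1 hr2]]]].
    fold th in hG, hr2; set (h := fun x => G x - G0 x) in *.
    assert (0 <= r1) by (eapply Rle_trans; [apply Rabs_pos|apply (hr1 z0)]).
    pose proof (proj1 hr2).
    destruct (hlock h r1 r2 hr2 ltac:(lra) hr1 ltac:(lra)) as [v [Cv [hv hco]]].
    apply (setR_of_cohomology lam th CG MG Cv eps G v p x0); auto; intro x.
    (* The penalty vanishes on the orbit, so it does not change the average there. *)
    assert (hsum : bsum G p x0 = bsum (fun y => F y + h y) p x0).
    { apply Rle_antisym; apply bsum_le; intros i _; unfold h, G0; rewrite orbit_dist_orbit; lra. }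
    rewrite hsum; specialize (hco x); unfold h at 1, G0 in hco; lra.
Qed.

Theorem mainTheorem15 (d : nat) (lam alpha : R)
  (hd : (0 < d)%nat) (hlam : 0 < lam < 1) (halpha : 0 < alpha) :
  contains_residual (d := d) lam alpha (fun A => setR lam A).
Proof.
  (* The union of all balls on which [setR] holds is open by the triangle inequality; this one set
     serves for every index. *)
  pose (U := fun F : Sigma d -> R => exists G0 r, norm_lt lam alpha (fun x => F x - G0 x) r /\
    forall G, is_holder lam alpha G -> norm_lt lam alpha (fun x => G x - G0 x) r -> setR lam G).
  exists (fun _ => U); split; [intros _; split|].
  - intros F hF [G0 [r [hr hgood]]].
    destruct (norm_lt_triangle lam alpha F G0 r hlam halpha hr) as [e [he htri]].
    exists e; split; [exact he|]; intros G hG hGF; exists G0, r; split; auto.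
  - intros F hF e he.
    destruct (dense_balls lam alpha e F (fun _ => exist _ 0%nat hd) hlam halpha hF he)
      as [G0 [r [hG0 [hclose [hr hgood]]]]].
    exists G0; split; [exact hG0|split; [|exact hclose]]; exists G0, r; split; [|exact hgood].
    apply norm_lt_iff; auto; exists 0, 0; split; [lra|split].
    + intro z; rewrite Rminus_diag, Rabs_R0; lra.
    + replace (fun x => G0 x - G0 x) with (fun _ : Sigma d => 0); [apply holder_const|].
      apply functional_extensionality; intro x; ring.
  - intros F hF hU; destruct (hU 0%nat) as [G0 [r [hr hgood]]]; auto.
Qed.
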